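(* Let $E\to\mathbb{R}^n$ be a vector bundle and let $\nabla$ be a soliton on $E$, i.e. a connection satisfying $D^*_\nabla F_\nabla+\frac{x}{2}\lrcorner F_\nabla=0$ on $\mathbb{R}^n$. If $|F_\nabla|(x)\le \frac38$ for all $x\in\mathbb{R}^n$, then $\nabla$ is flat, i.e. $F_\nabla\equiv 0$.
   Context: $E\to\mathbb{R}^n$ is a smooth real vector bundle with a fibre metric over Euclidean space; connections are smooth and metric-compatible. Repeated indices are summed. The curvature has components $F_{ij}=[\nabla_i,\nabla_j]$, skew-symmetric endomorphisms of $E$. For skew endomorphisms $\langle A,B\rangle=-\mathrm{tr}(AB)$; $|F|^2=\sum_{i,j=1}^n|F_{ij}|^2$ (sum over all ordered pairs). $(D^*F)_j=-\nabla_iF_{ij}$, and for a vector field $V$, $(V\lrcorner F)_j=V^iF_{ij}$; $x$ denotes the position vector field. *)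

(* Defs.v *)
From HB Require Import structures.
From mathcomp Require Import all_boot all_order all_algebra.
From mathcomp Require Import all_classical all_reals all_analysis.

Set Implicit Arguments.
Unset Strict Implicit.
Unset Printing Implicit Defensive.

Import Order.TTheory GRing.Theory Num.Theory.
Import numFieldNormedType.Exports.

Local Open Scope classical_set_scope.
Local Open Scope ring_scope.

(* [ebase i] is the i-th vector of the standard basis of R^n; the norm that
   MathComp-Analysis puts on ['rV[R]_n] is the sup norm, which is used here only
   through the topology and the directional derivatives ['D_v f]. *)
Definition ebase (R : realType) (n : nat) (i : 'I_n) : 'rV[R]_n := delta_mx 0 i.

Fixpoint Ck (R : realType) (n : nat) (V : normedModType R) (k : nat)
    (U : set 'rV[R]_n) (f : 'rV[R]_n -> V) : Prop :=
  match k with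
  | 0 => forall x, U x -> {for x, continuous f}
  | k'.+1 => (forall x, U x -> {for x, continuous f}) /\
      forall i : 'I_n, (forall x, U x -> derivable f x (ebase R i)) /\
        Ck k' U (fun x => 'D_(ebase R i) f x)
  end.

(* Only used for U open, so that everything depends on the restriction of f to
   U alone. *)
Definition smooth (R : realType) (n : nat) (V : normedModType R)
    (U : set 'rV[R]_n) (f : 'rV[R]_n -> V) : Prop :=
  forall k, Ck k U f.

(* A smooth real vector bundle over R^n, given by its fibres and a smooth atlas
   of fibrewise linear local trivialisations. The maps [triv a x] are
   meaningful only for x in the domain of the chart a. *)
Record vector_bundle (R : realType) (n : nat) := VectorBundle {
  fibre :> 'rV[R]_n -> vectType R;
  rank : nat;
  chart : Type;
  dom : chart -> set 'rV[R]_n;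
  triv : chart -> forall x, 'Hom(fibre x, 'rV[R]_rank);
  dom_open : forall a, open (dom a);
  dom_cover : forall x, exists a, dom a x;
  triv_bij : forall a x, dom a x -> bijective (triv a x);
  triv_smooth : forall a b (v : 'rV[R]_rank),
    smooth (dom a `&` dom b) (fun x => triv a x ((triv b x)^-1%VF v))
}.

Definition section (R : realType) (n : nat) (E : vector_bundle R n) :=
  forall x, E x.

Definition smooth_section (R : realType) (n : nat) (E : vector_bundle R n)
    (U : set 'rV[R]_n) (s : section E) : Prop :=
  forall a : chart E, smooth (U `&` dom a) (fun x => triv a x (s x)).

Record fibre_metric (R : realType) (n : nat) (E : vector_bundle R n) :=
  FibreMetric {
  metric :> forall x, {dot (E x) for idfun};
  metric_smooth : forall (U : set 'rV[R]_n) (s t : section E), open U ->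
    smooth_section U s -> smooth_section U t ->
    smooth U (fun x => (metric x (s x) (t x) : R))
}.

(* A smooth connection compatible with the metric h: [nabla s x v] is the
   covariant derivative at x of the section s in the direction v. A section over
   an open set U is represented by an arbitrary extension to R^n, and
   [nabla_local] says that the value on U does not depend on the extension. *)
Record connection (R : realType) (n : nat) (E : vector_bundle R n)
    (h : fibre_metric E) := Connection {
  nabla :> section E -> forall x, 'Hom('rV[R]_n, E x);
  nabla_local : forall (U : set 'rV[R]_n) (s t : section E), open U ->
    smooth_section U s -> (forall x, U x -> s x = t x) ->
    forall x, U x -> nabla s x = nabla t x;
  nabla_smooth : forall (U : set 'rV[R]_n) (s : section E) (v : 'rV[R]_n),
    open U -> smooth_section U s -> smooth_section U (fun x => nabla s x v);
  nablaD : forall (U : set 'rV[R]_n) (s t : section E), open U ->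
    smooth_section U s -> smooth_section U t ->
    forall x, U x -> nabla (fun y => s y + t y) x = nabla s x + nabla t x;
  nabla_leibniz : forall (U : set 'rV[R]_n) (f : 'rV[R]_n -> R)
      (s : section E), open U -> smooth U f -> smooth_section U s ->
    forall x, U x -> forall v,
      nabla (fun y => f y *: s y) x v = 'D_v f x *: s x + f x *: nabla s x v;
  nabla_metric : forall (U : set 'rV[R]_n) (s t : section E), open U ->
    smooth_section U s -> smooth_section U t ->
    forall x, U x -> forall v,
      'D_v (fun y => (h y (s y) (t y) : R)) x
        = h x (nabla s x v) (t x) + h x (s x) (nabla t x v)
}.

(* The endomorphism A of the fibre at x such that A (s x) = T s for every smooth
   local section s around x. It exists, and is unique, when T is C^oo-linear
   (tensorial); the default value 0 is then irrelevant. *)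
Definition tensor_at (R : realType) (n : nat) (E : vector_bundle R n)
    (x : 'rV[R]_n) (T : section E -> E x) : 'End(E x) :=
  xget 0 [set A : 'End(E x) | forall (U : set 'rV[R]_n) (s : section E),
    open U -> U x -> smooth_section U s -> A (s x) = T s].

Definition endo_field (R : realType) (n : nat) (E : vector_bundle R n) :=
  forall x, 'End(E x).

Definition cov (R : realType) (n : nat) (E : vector_bundle R n)
    (h : fibre_metric E) (D : connection h) (i : 'I_n) (s : section E) :
    section E :=
  fun x => D s x (ebase R i).

(* F_ij = [nabla_i, nabla_j]; the coordinate vector fields commute. *)
Definition curvature (R : realType) (n : nat) (E : vector_bundle R n)
    (h : fibre_metric E) (D : connection h) (i j : 'I_n) : endo_field E :=
  fun x => tensor_at (fun s => cov D i (cov D j s) x - cov D j (cov D i s) x).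

(* The induced connection on End(E):
   (nabla_i A) s = nabla_i (A s) - A (nabla_i s). *)
Definition cov_endo (R : realType) (n : nat) (E : vector_bundle R n)
    (h : fibre_metric E) (D : connection h) (i : 'I_n) (A : endo_field E) :
    endo_field E :=
  fun x => tensor_at (fun s => cov D i (fun y => A y (s y)) x
                               - A x (cov D i s x)).

Definition Dstar (R : realType) (n : nat) (E : vector_bundle R n)
    (h : fibre_metric E) (D : connection h) (F : 'I_n -> 'I_n -> endo_field E)
    (j : 'I_n) : endo_field E :=
  fun x => - \sum_(i < n) cov_endo D i (F i j) x.

Definition vcontract (R : realType) (n : nat) (E : vector_bundle R n)
    (V : 'rV[R]_n -> 'rV[R]_n) (F : 'I_n -> 'I_n -> endo_field E)
    (j : 'I_n) : endo_field E :=
  fun x => \sum_(i < n) V x 0 i *: F i j x.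

Definition soliton (R : realType) (n : nat) (E : vector_bundle R n)
    (h : fibre_metric E) (D : connection h) : Prop :=
  forall (x : 'rV[R]_n) (j : 'I_n),
    Dstar D (curvature D) j x
      + vcontract (fun y => 2^-1 *: y) (curvature D) j x = 0.

Definition flat (R : realType) (n : nat) (E : vector_bundle R n)
    (h : fibre_metric E) (D : connection h) : Prop :=
  forall (x : 'rV[R]_n) (i j : 'I_n), curvature D i j x = 0.

Definition trace (R : realType) (V : vectType R) (A : 'End(V)) : R :=
  \tr (passmx.mxof (vbasis {:V}) (vbasis {:V}) A).

Definition endo_inner (R : realType) (V : vectType R) (A B : 'End(V)) : R :=
  - trace (A \o B)%VF.

Definition curvature_norm (R : realType) (n : nat) (E : vector_bundle R n)
    (h : fibre_metric E) (D : connection h) (x : 'rV[R]_n) : R :=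
  Num.sqrt (\sum_(i < n) \sum_(j < n)
    endo_inner (curvature D i j x) (curvature D i j x)).

(* Main.v *)
Require Import Defs.
From mathcomp Require Import all_boot all_order all_algebra.
From mathcomp Require Import all_classical all_reals all_analysis.
From mathcomp Require Import ring lra.

Set Implicit Arguments.
Unset Strict Implicit.
Unset Printing Implicit Defensive.

Import Order.TTheory GRing.Theory Num.Theory.
Import numFieldNormedType.Exports.

Local Open Scope classical_set_scope.
Local Open Scope ring_scope.

(** The function u = |F|^2 = - sum tr (F_ij F_ij) satisfies a differential
    inequality for the drift Laplacian L = Laplacian - (x/2).grad. The Bianchi
    identity, the Ricci commutation [nabla_i, nabla_j] M = [M, F_ij] and the
    soliton equation give L F_ij = F_ij - 2 sum_k [F_ki, F_kj] for the covariant
    L, hence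
      L u = 2 |nabla F|^2 + 2 u + 4 sum_ijk tr ([F_ki, F_kj] F_ij).
    Skew matrices satisfy tr ([A, B] C)^2 <= (8/5) |A|^2 |B|^2 |C|^2, so the cubic
    term is at most 4 sqrt(8/5) u^(3/2) in absolute value, which for
    |F| <= 3/8 is at most (19/10) u. Thus L u >= u/10 with u bounded, and
    comparing u with e |x|^2 at a maximum point gives u <= 0. *)

(** * Skew matrices *)

(** The size of the cubic constant is the crux. With a constant $\kappa$ in place of 8/5 the cubic
    term is at most $4\sqrt{\kappa}\,|F|\,u$, and for $|F|\le 3/8$ this bound stays strictly below
    $2u$ exactly when $\kappa<16/9$. The elementary estimate $|vA|^2\le\frac12|A|^2$ for skew [A]
    and unit [v] yields only $\kappa=2$, which is too weak; splitting off a single rank-two piece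
    already brings the constant down to 8/5. Strictness matters because $\mathbb{R}^n$ is not
    compact: [u] need not attain its maximum, and the comparison with $e|x|^2$ relies on the
    positive coefficient 1/10 left in front of [u].

    The second obstacle is that trivialisations are arbitrary linear charts, so the fibre metric has
    a variable Gram matrix [H] and skewness reads $AH+HA^T=0$. No smooth orthonormal frame is built:
    the differential identities are derived with [H] as it is, and since traces are invariant under
    conjugation, a Cholesky factor of [H] at one point turns each algebraic inequality into one
    about skew matrices. *)

Section FrobeniusNorm.
Variable R : rcfType.

Definition frob m n (A B : 'M[R]_(m, n)) : R := \tr (A *m B^T).

Definition frob2 m n (A : 'M[R]_(m, n)) : R := frob A A.

Definition skew n (A : 'M[R]_n) := A^T = - A.

Lemma frobC m n (A B : 'M[R]_(m, n)) : frob A B = frob B A.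
Proof. by rewrite /frob -mxtrace_tr trmx_mul trmxK. Qed.

Lemma frobDl m n (A B C : 'M[R]_(m, n)) : frob (A + B) C = frob A C + frob B C.
Proof. by rewrite /frob mulmxDl linearD. Qed.

Lemma frobZl m n a (A C : 'M[R]_(m, n)) : frob (a *: A) C = a * frob A C.
Proof. by rewrite /frob -scalemxAl linearZ. Qed.

Lemma frobNl m n (A C : 'M[R]_(m, n)) : frob (- A) C = - frob A C.
Proof. by rewrite /frob mulNmx linearN. Qed.

Lemma frobDr m n (A B C : 'M[R]_(m, n)) : frob C (A + B) = frob C A + frob C B.
Proof. by rewrite !(frobC C) frobDl. Qed.

Lemma frobZr m n a (A C : 'M[R]_(m, n)) : frob C (a *: A) = a * frob C A.
Proof. by rewrite !(frobC C) frobZl. Qed.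

Lemma frobNr m n (A C : 'M[R]_(m, n)) : frob C (- A) = - frob C A.
Proof. by rewrite !(frobC C) frobNl. Qed.

Lemma frobE m n (A B : 'M[R]_(m, n)) : frob A B = \sum_i \sum_j A i j * B i j.
Proof.
rewrite /frob /mxtrace; apply: eq_bigr => i _; rewrite mxE.
by apply: eq_bigr => j _; rewrite mxE.
Qed.

Lemma frob2_ge0 m n (A : 'M[R]_(m, n)) : 0 <= frob2 A.
Proof.
rewrite /frob2 frobE; apply: sumr_ge0 => i _; apply: sumr_ge0 => j _.
by rewrite -expr2 sqr_ge0.
Qed.

Lemma frob2_eq0 m n (A : 'M[R]_(m, n)) : (frob2 A == 0) = (A == 0).
Proof.
apply/eqP/eqP => [|->]; last by rewrite /frob2 /frob mul0mx mxtrace0.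
rewrite /frob2 frobE => /eqP.
have ge0 i j : 0 <= A i j * A i j by rewrite -expr2 sqr_ge0.
rewrite psumr_eq0 => [|i _]; last by rewrite sumr_ge0.
move=> /allP H; apply/matrixP => i j; have := H i (mem_index_enum _).
rewrite psumr_eq0 => [|k _]; last by rewrite ge0.
move=> /allP /(_ j (mem_index_enum _)) /=.
by rewrite mulf_eq0 orbb mxE => /eqP.
Qed.

Lemma frob2_scale m n a (A : 'M[R]_(m, n)) : frob2 (a *: A) = a ^+ 2 * frob2 A.
Proof. by rewrite /frob2 frobZl frobZr; ring. Qed.

Lemma frob2B m n (A B : 'M[R]_(m, n)) :
  frob2 (A - B) = frob2 A - 2 * frob A B + frob2 B.
Proof.
by rewrite /frob2 !(frobDl, frobDr, frobNl, frobNr) (frobC B A); ring.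
Qed.

Lemma frob_cauchy_schwarz m n (A B : 'M[R]_(m, n)) :
  frob A B ^+ 2 <= frob2 A * frob2 B.
Proof.
have [B0|B0] := eqVneq B 0.
  by rewrite B0 /frob2 /frob trmx0 !mulmx0 mxtrace0 mulr0 expr0n.
have NB : 0 < frob2 B by rewrite lt_def frob2_eq0 B0 frob2_ge0.
have := frob2_ge0 (frob2 B *: A - frob A B *: B).
rewrite /frob2 !(frobDl, frobDr, frobNl, frobNr, frobZl, frobZr) (frobC B A).
rewrite -/(frob2 A) -/(frob2 B) => H.
rewrite -(ler_pM2l NB) -subr_ge0; apply: le_trans H _.
by rewrite le_eqVlt; apply/orP; left; apply/eqP; ring.
Qed.

Lemma mxtrace11 (A : 'M[R]_1) : \tr A = A 0 0.
Proof. by rewrite /mxtrace big_ord1. Qed.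

Lemma frob_mxtraceC m n (v : 'rV[R]_n) (A : 'M[R]_(n, m)) (w : 'rV[R]_m) :
  \tr (w^T *m v *m A) = frob (v *m A) w.
Proof. by rewrite -mulmxA mxtrace_mulC. Qed.

Lemma frob_skew n (B : 'M[R]_n) (v w : 'rV[R]_n) : skew B ->
  frob (v *m B) w = - frob v (w *m B).
Proof.
by move=> sB; rewrite /frob trmx_mul sB mulNmx mulmxN linearN opprK mulmxA.
Qed.

Lemma frob_skew_diag n (B : 'M[R]_n) (v : 'rV[R]_n) : skew B ->
  frob (v *m B) v = 0.
Proof. by move=> sB; have := frob_skew v v sB; rewrite frobC; lra. Qed.

(** The wedge product $v\wedge w$ as a matrix of rank at most two. For skew [A] and unit [v],
    [bivector v (v *m A)] is the piece of [A] that gets split off below. *)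
Definition bivector n (v w : 'rV[R]_n) : 'M[R]_n := v^T *m w - w^T *m v.

Lemma bivector_skew n (v w : 'rV[R]_n) : skew (bivector v w).
Proof. by rewrite /skew /bivector linearB /= !trmx_mul !trmxK opprB. Qed.

Lemma skewB n (A B : 'M[R]_n) : skew A -> skew B -> skew (A - B).
Proof. by rewrite /skew => sA sB; rewrite linearB /= sA sB opprB opprK addrC. Qed.

Lemma frob_bivector n (v w : 'rV[R]_n) (A : 'M[R]_n) : skew A ->
  frob (bivector v w) A = 2 * frob (v *m A) w.
Proof.
move=> sA; rewrite {1}/frob sA mulmxN linearN /= /bivector mulmxBl linearB /=.
rewrite !frob_mxtraceC (frob_skew w v sA) (frobC w); lra.
Qed.

Lemma mulmx_bivector n (u v w : 'rV[R]_n) :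
  u *m bivector v w = frob u v *: w - frob u w *: v.
Proof.
rewrite /bivector mulmxBr !mulmxA.
by rewrite [u *m v^T]mx11_scalar [u *m w^T]mx11_scalar !mul_scalar_mx /frob !mxtrace11.
Qed.

Lemma frob2_bivector n (v w : 'rV[R]_n) : frob2 v = 1 -> frob v w = 0 ->
  frob2 (bivector v w) = 2 * frob2 w.
Proof.
move=> v1 vw; rewrite {1}/frob2 frob_bivector; last exact: bivector_skew.
rewrite mulmx_bivector frobDl frobNl !frobZl -/(frob2 v) v1 vw.
by rewrite -/(frob2 w); ring.
Qed.

(** Pythagoras: since $w=vA$ is orthogonal to $v$, both $\langle v\wedge w,A\rangle$ and $|v\wedge
    w|^2$ equal $2|w|^2$, so the remainder is orthogonal to the bivector. *)
Lemma frob2_peel n (A : 'M[R]_n) (v : 'rV[R]_n) : skew A -> frob2 v = 1 ->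
  frob2 (A - bivector v (v *m A)) = frob2 A - 2 * frob2 (v *m A).
Proof.
move=> sA v1; set w := v *m A.
have vw : frob v w = 0 by rewrite frobC frob_skew_diag.
by rewrite frob2B frob2_bivector // frobC frob_bivector // -/(frob2 w); ring.
Qed.

(** Nonnegativity of the remainder in [frob2_peel]. The factor 2 reflects that the nonzero singular
    values of a skew matrix come in equal pairs. *)
Lemma frob2_mulmx_unit n (A : 'M[R]_n) (v : 'rV[R]_n) : skew A ->
  frob2 v = 1 -> 2 * frob2 (v *m A) <= frob2 A.
Proof.
move=> sA v1; have := frob2_ge0 (A - bivector v (v *m A)).
by rewrite frob2_peel //; lra.
Qed.

Lemma frob2_normalize n (v : 'rV[R]_n) : v != 0 ->
  exists2 w : 'rV[R]_n, frob2 w = 1 & v = Num.sqrt (frob2 v) *: w.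
Proof.
move=> v0; have v2 : 0 < frob2 v by rewrite lt_def frob2_eq0 v0 frob2_ge0.
have s0 : Num.sqrt (frob2 v) != 0 by rewrite gt_eqF // sqrtr_gt0.
exists ((Num.sqrt (frob2 v))^-1 *: v).
  by rewrite frob2_scale exprVn sqr_sqrtr ?mulVf ?gt_eqF // ltW.
by rewrite scalerA divff // scale1r.
Qed.

Lemma frob2_mulmx n (A : 'M[R]_n) (v : 'rV[R]_n) (k : R) :
  (forall w : 'rV[R]_n, frob2 w = 1 -> frob2 (w *m A) <= k) ->
  frob2 (v *m A) <= k * frob2 v.
Proof.
move=> H; have [->|v0] := eqVneq v 0.
  by rewrite mul0mx /frob2 /frob mul0mx mxtrace0 mulr0.
have [w w1 ->] := frob2_normalize v0.
rewrite -scalemxAl !frob2_scale w1 mulr1 mulrC.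
by apply: ler_wpM2r; [exact: sqr_ge0 | exact: H].
Qed.

Lemma frob2_rows m n (A : 'M[R]_(m, n)) : frob2 A = \sum_i frob2 (row i A).
Proof.
rewrite /frob2 frobE; apply: eq_bigr => i _; rewrite frobE big_ord1.
by apply: eq_bigr => j _; rewrite !mxE.
Qed.

Lemma frob2_mulmx_le m n (A : 'M[R]_n) (B : 'M[R]_(m, n)) (k : R) :
  (forall w : 'rV[R]_n, frob2 w = 1 -> frob2 (w *m A) <= k) ->
  frob2 (B *m A) <= k * frob2 B.
Proof.
move=> H; rewrite !frob2_rows mulr_sumr; apply: ler_sum => i _.
by rewrite row_mul; apply: frob2_mulmx.
Qed.

(** Here [k] bounds the squared operator norm of [A]. Writing the trace as $\langle CA,B^T\rangle$,
    Cauchy-Schwarz leaves $|CA|$, in which every row of [C] meets only the operator norm of [A]. *)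
Lemma mxtrace3_op n (A B C : 'M[R]_n) (k : R) : skew C ->
  (forall w : 'rV[R]_n, frob2 w = 1 -> frob2 (w *m A) <= k) ->
  \tr (A *m B *m C) ^+ 2 <= k * frob2 B * frob2 C.
Proof.
move=> sC H; rewrite -mulmxA mxtrace_mulC -mulmxA.
have -> : \tr (B *m (C *m A)) = frob (C *m A) B^T by rewrite mxtrace_mulC /frob trmxK.
apply: le_trans (frob_cauchy_schwarz _ _) _.
have -> : frob2 B^T = frob2 B by rewrite /frob2 /frob trmxK mxtrace_mulC.
rewrite -mulrA (mulrC (frob2 B)) mulrA ler_wpM2r ?frob2_ge0 //.
exact: frob2_mulmx_le.
Qed.

(** In an orthonormal basis starting with [v], [w], the left side adds up the squared entries of [B]
    in two rows and the two matching columns; the correction removes the entries at $(v,w)$ and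
    $(w,v)$, which lie in both. The proof splits off the bivector of [v] and applies the one-vector
    bound for [w] to the remainder. *)
Lemma frob2_two_rows n (B : 'M[R]_n) (v w : 'rV[R]_n) : skew B ->
  frob2 v = 1 -> frob2 w = 1 -> frob v w = 0 ->
  2 * frob2 (v *m B) + 2 * frob2 (w *m B) - 2 * frob (v *m B) w ^+ 2
    <= frob2 B.
Proof.
move=> sB v1 w1 vw; set p := v *m B.
have sB' : skew (B - bivector v p) by apply: skewB => //; exact: bivector_skew.
have := frob2_mulmx_unit sB' w1; rewrite frob2_peel // mulmxBr mulmx_bivector.
rewrite (frobC w v) vw scale0r sub0r opprK -/p.
rewrite {1}/frob2 frobDl !frobDr !(frobZl, frobZr) -!/(frob2 _) v1 (frobC w p).
have -> : frob (w *m B) v = - frob p w by rewrite frob_skew // frobC.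
have -> : frob v (w *m B) = - frob p w by rewrite frobC frob_skew // frobC.
lra.
Qed.

Lemma sqr_cross_le (p2 q2 P2 Q2 s t NB NC : R) :
  0 <= p2 -> 0 <= q2 -> 0 <= P2 -> 0 <= Q2 ->
  2 * p2 + 2 * q2 <= NB -> 2 * P2 + 2 * Q2 <= NC ->
  s ^+ 2 <= q2 * P2 -> t ^+ 2 <= Q2 * p2 ->
  (2 * (s - t)) ^+ 2 <= NB * NC.
Proof.
move=> hp hq hP hQ hB hC hs ht.
have hst : (s - t) ^+ 2 <= (p2 + q2) * (P2 + Q2).
  (* AM-GM after regrouping $s^2t^2\le(q_2Q_2)(p_2P_2)$: the cross term supplies exactly the two
     products that the bounds on $s^2$ and $t^2$ lack to complete $(p_2+q_2)(P_2+Q_2)$. *)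
  have st : 2 * `|s * t| <= q2 * Q2 + p2 * P2.
    rewrite -(@ler_pXn2r _ 2) ?nnegrE ?mulr_ge0 ?addr_ge0 ?mulr_ge0 //.
    rewrite exprMn -normrX ger0_norm ?sqr_ge0 // exprMn.
    have : s ^+ 2 * t ^+ 2 <= (q2 * P2) * (Q2 * p2) by apply: ler_pM; rewrite ?sqr_ge0.
    have := sqr_ge0 (q2 * Q2 - p2 * P2).
    nra.
  have := ler_norm (- (s * t)); rewrite normrN; nra.
have : (p2 + q2) * (P2 + Q2) <= (NB / 2) * (NC / 2) by apply: ler_pM; lra.
nra.
Qed.

(** As $|v\wedge w|^2=2|w|^2$, the bound is $\frac12|v\wedge w|^2|B|^2|C|^2$, far better than the
    general one. The trace sees only two rows of [B] and two of [C], and the components of such rows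
    orthogonal to the plane of [v] and [w] carry at most half of the squared norm. *)
Lemma mxtrace3_bivector n (v w : 'rV[R]_n) (B C : 'M[R]_n) : skew B -> skew C ->
  frob2 v = 1 -> frob v w = 0 ->
  (2 * \tr (bivector v w *m B *m C)) ^+ 2 <= frob2 w * frob2 B * frob2 C.
Proof.
move=> sB sC v1 vw; have [w0|w0] := eqVneq w 0.
  rewrite w0 /bivector trmx0 mul0mx mulmx0 subrr !mul0mx mxtrace0.
  by rewrite /frob2 [in frob 0 0]/frob mul0mx mxtrace0 mulr0 expr0n /= !mul0r.
have [u u1 defw] := frob2_normalize w0.
have s0 : Num.sqrt (frob2 w) != 0.
  by rewrite gt_eqF // sqrtr_gt0 lt_def frob2_eq0 w0 frob2_ge0.
have vu : frob v u = 0.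
  by move: vw; rewrite defw frobZr => /eqP; rewrite mulf_eq0 (negPf s0) => /eqP.
have -> : bivector v w = Num.sqrt (frob2 w) *: bivector v u.
  by rewrite {1}defw /bivector -scalemxAr linearZ /= -scalemxAl scalerBr.
rewrite -!scalemxAl linearZ /= mulrCA exprMn sqr_sqrtr ?frob2_ge0 //.
rewrite -[leRHS]mulrA ler_wpM2l ?frob2_ge0 //.
set p := v *m B; set q := u *m B; set P := v *m C; set Q := u *m C.
set b := frob p u; set c := frob P u.
have qv : frob q v = - b by rewrite frob_skew // frobC.
have Qv : frob Q v = - c by rewrite frob_skew // frobC.
have pv : frob p v = 0 by rewrite frob_skew_diag.
have Pv : frob P v = 0 by rewrite frob_skew_diag.
have qu : frob q u = 0 by rewrite frob_skew_diag.
have Qu : frob Q u = 0 by rewrite frob_skew_diag.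
have uv : frob u v = 0 by rewrite frobC.
(* Inside the plane, [Q] and [q] have components along [v] only, [P] and [p] along [u] only. These
   are orthogonal, so the pairings involve just the projections off the plane. *)
have -> : \tr (bivector v u *m B *m C) = frob (Q + c *: v) (p - b *: u)
   - frob (q + b *: v) (P - c *: u).
  rewrite -mulmxA /bivector mulmxBl linearB /= !frob_mxtraceC !mulmxA.
  rewrite (frob_skew _ v sC) (frob_skew _ u sC) -/p -/q -/P -/Q (frobC p Q).
  rewrite !(frobDl, frobDr, frobNl, frobNr, frobZl, frobZr).
  by rewrite !(frobC v) Qu qu Pv pv uv; ring.
rewrite [leRHS]mulrC.
apply: (@sqr_cross_le (frob2 (P - c *: u)) (frob2 (Q + c *: v))
   (frob2 (p - b *: u)) (frob2 (q + b *: v))); rewrite ?frob2_ge0 //.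
- have := frob2_two_rows sC v1 u1 vu; rewrite -/P -/Q -/c.
  rewrite /frob2 !(frobDl, frobDr, frobNl, frobNr, frobZl, frobZr).
  rewrite !(frobC v) !(frobC u) Qv -/c -!/(frob2 _) v1 u1; nra.
- have := frob2_two_rows sB v1 u1 vu; rewrite -/p -/q -/b.
  rewrite /frob2 !(frobDl, frobDr, frobNl, frobNr, frobZl, frobZr).
  rewrite !(frobC v) !(frobC u) qv -/b -!/(frob2 _) v1 u1; nra.
- exact: frob_cauchy_schwarz.
- exact: frob_cauchy_schwarz.
Qed.

(* Either |v A|^2 <= (2/5) |A|^2 for all unit vectors v, or subtracting a bivector
   that carries more than 4/5 of |A|^2 leaves a small remainder. *)
Lemma mxtrace3_skew n (A B C : 'M[R]_n) : skew A -> skew B -> skew C ->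
  (2 * \tr (A *m B *m C)) ^+ 2 <= 8 / 5 * (frob2 A * frob2 B * frob2 C).
Proof.
move=> sA sB sC.
have NBC : 0 <= frob2 B * frob2 C by rewrite mulr_ge0 ?frob2_ge0.
have [H|] := pselect (forall w : 'rV[R]_n, frob2 w = 1 ->
    frob2 (w *m A) <= 2 / 5 * frob2 A).
  have := mxtrace3_op B sC H; nra.
move=> /existsNP[v /not_implyP[v1 /negP]]; rewrite -ltNge => hv.
set w := v *m A in hv *; set A' := A - bivector v w.
have sA' : skew A' by apply: skewB => //; exact: bivector_skew.
have vw : frob v w = 0 by rewrite frobC frob_skew_diag.
have := mxtrace3_bivector sB sC v1 vw.
have := @mxtrace3_op _ A' B C (frob2 A' / 2) sC _.
rewrite frob2_peel // -/w => /(_ _)/wrap[u u1|]; last first.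
  have -> : \tr (A *m B *m C) = \tr (bivector v w *m B *m C) + \tr (A' *m B *m C).
    by rewrite -linearD /= -!mulmxDl addrC subrK.
  set t := \tr (bivector _ _ *m B *m C); set t' := \tr _ => h1 h2.
  (* By $(t+t')^2\le 2t^2+2t'^2$ the left side is at most $(4|A|^2-6|w|^2)|B|^2|C|^2$. A threshold
     $\theta$ for $|w|^2/|A|^2$ would give the constants $4\theta$ and $4-6\theta$ in the two cases;
     they agree at $\theta=2/5$, with value 8/5. *)
  have := sqr_ge0 (t - t').
  have : 0 <= (frob2 w - 2 / 5 * frob2 A) * (frob2 B * frob2 C).
    by rewrite mulr_ge0 // subr_ge0 ltW.
  nra.
by have := frob2_mulmx_unit sA' u1; rewrite /A' frob2_peel // -/w; lra.
Qed.

End FrobeniusNorm.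

(** * Summation of the cubic term over index triples *)

Section CommutatorBound.
Variable R : rcfType.

(** Transposing $BAC$ reverses the order and produces three signs, so
    $\mathrm{tr}(BAC)=-\mathrm{tr}(CAB)=-\mathrm{tr}(ABC)$. *)
Lemma mxtrace_comm_skew n (A B C : 'M[R]_n) : skew A -> skew B -> skew C ->
  \tr ((A *m B - B *m A) *m C) = 2 * \tr (A *m B *m C).
Proof.
move=> sA sB sC; rewrite mulmxBl linearB /=.
have -> : \tr (B *m A *m C) = - \tr (A *m B *m C).
  rewrite -mxtrace_tr !trmx_mul sA sB sC !(mulNmx, mulmxN) !opprK.
  by rewrite linearN /= mxtrace_mulC.
by ring.
Qed.

Lemma frob2_gram m n (a : 'M[R]_(m, n)) : frob2 (a^T *m a) <= frob2 a ^+ 2.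
Proof.
have rowE i j : (a^T *m a) i j = frob (row i a^T) (row j a^T).
  by rewrite mxE frobE big_ord1; apply: eq_bigr => k _; rewrite !mxE.
have Na : frob2 a = frob2 a^T by rewrite /frob2 /frob trmxK mxtrace_mulC.
rewrite {1}/frob2 frobE Na expr2 {1}frob2_rows mulr_suml.
apply: ler_sum => i _; rewrite (frob2_rows a^T) mulr_sumr; apply: ler_sum => j _.
by rewrite rowE -expr2; exact: frob_cauchy_schwarz.
Qed.

Lemma frob_gram m n (a : 'M[R]_(m, n)) (b : 'M[R]_n) :
  frob b (a^T *m a) ^+ 2 <= frob2 b * frob2 a ^+ 2.
Proof.
apply: le_trans (frob_cauchy_schwarz _ _) _.
by rewrite ler_wpM2l ?frob2_ge0 ?frob2_gram.
Qed.

(** With $a_{ij}=|F_{ij}|$ the sum is at most $\sqrt{8/5}$ times $\sum a_{ij}a_{ki}a_{kj}=\langle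
    a,a^Ta\rangle\le|a|^3$. Treating the norms as one matrix avoids any factor depending on [n]. *)
Lemma sum_mxtrace3_skew n r (F : 'I_n -> 'I_n -> 'M[R]_r) :
  (forall i j, skew (F i j)) ->
  (\sum_i \sum_j \sum_k 2 * \tr (F k i *m F k j *m F i j)) ^+ 2
    <= 8 / 5 * (\sum_i \sum_j frob2 (F i j)) ^+ 3.
Proof.
move=> sF; pose a := \matrix_(i, j) Num.sqrt (frob2 (F i j)).
have aE i j : a i j ^+ 2 = frob2 (F i j) by rewrite mxE sqr_sqrtr ?frob2_ge0.
have a0 i j : 0 <= a i j by rewrite mxE sqrtr_ge0.
have -> : \sum_i \sum_j frob2 (F i j) = frob2 a.
  rewrite [RHS]frobE; apply: eq_bigr => i _; apply: eq_bigr => j _.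
  by rewrite -expr2 aE.
pose s := Num.sqrt (8 / 5 : R).
have s2 : s ^+ 2 = 8 / 5 by rewrite sqr_sqrtr //; lra.
have term i j k : `|2 * \tr (F k i *m F k j *m F i j)| <= s * (a i j * (a k i * a k j)).
  rewrite -(@ler_pXn2r _ 2) ?nnegrE ?mulr_ge0 ?sqrtr_ge0 //.
  rewrite -normrX ger0_norm ?sqr_ge0 // !exprMn s2 -exprMn !aE.
  apply: le_trans (mxtrace3_skew (sF _ _) (sF _ _) (sF _ _)) _.
  by rewrite le_eqVlt; apply/orP; left; apply/eqP; ring.
have H : `|\sum_i \sum_j \sum_k 2 * \tr (F k i *m F k j *m F i j)|
    <= s * frob a (a^T *m a).
  rewrite frobE [leRHS]mulr_sumr; apply: le_trans (ler_norm_sum _ _ _) _.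
  apply: ler_sum => i _; apply: le_trans (ler_norm_sum _ _ _) _.
  rewrite [leRHS]mulr_sumr; apply: ler_sum => j _.
  apply: le_trans (ler_norm_sum _ _ _) _.
  rewrite [(_ *m _) i j]mxE mulr_sumr [leRHS]mulr_sumr; apply: ler_sum => k _.
  by rewrite [a^T _ _]mxE.
rewrite -[leLHS]ger0_norm ?sqr_ge0 // normrX.
have := ler_pM (normr_ge0 _) (normr_ge0 _) H H; rewrite -!expr2 exprMn s2.
move=> {}H; apply: le_trans H _; apply: ler_wpM2l; first by lra.
by rewrite exprS frob_gram.
Qed.

End CommutatorBound.

(** * Positive definite Gram matrices and reduction to an orthonormal basis *)

Section Cholesky.
Variable R : rcfType.

Definition posdef n (H : 'M[R]_n) :=
  H^T = H /\ forall v : 'rV[R]_n, v != 0 -> 0 < \tr (v *m H *m v^T).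

(** Used at one point at a time, to pass from the Gram matrix of an arbitrary frame to an
    orthonormal one. Induction on the size: the Schur complement $D-a^{-1}b^Tb$ is again positive
    definite. *)
Lemma cholesky n (H : 'M[R]_n) : posdef H ->
  exists2 S : 'M[R]_n, S \in unitmx & H = S *m S^T.
Proof.
elim: n H => [|n IH] H [sH pH].
  by exists 1%:M; [exact: unitmx1 | apply/matrixP => -[]].
change 'M[R]_(1 + n) in H.
have {}pH (v : 'rV[R]_(1 + n)) : v != 0 -> 0 < \tr (v *m H *m v^T) := pH v.
pose a := H 0 0; pose b := ursubmx H; pose D := drsubmx H.
have HE : H = block_mx a%:M b b^T D.
  rewrite -[LHS]submxK; congr block_mx.
    by rewrite [ulsubmx H]mx11_scalar !mxE; congr (H _ _)%:M; apply/val_inj.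
  by rewrite /b trmx_ursub sH.
have a0 : 0 < a.
  have := pH (row_mx 1 0) _; rewrite HE mul_row_block !mul1mx !mul0mx !addr0.
  rewrite tr_row_mx mul_row_col !trmx1 trmx0 mulmx0 addr0 mulmx1 mxtrace_scalar mulr1n.
  apply; apply/eqP => /matrixP /(_ 0 (lshift _ 0)); rewrite row_mxEl !mxE.
  by move/eqP; rewrite oner_eq0.
have sD : D^T = D by rewrite /D trmx_drsub sH.
have a_neq0 : a != 0 by rewrite gt_eqF.
have sa2 : Num.sqrt a * Num.sqrt a = a by rewrite -expr2 sqr_sqrtr // ltW.
have sa0 : Num.sqrt a != 0 by rewrite gt_eqF // sqrtr_gt0.
have [|S uS DE] := IH (D - a^-1 *: (b^T *m b)).
  split; first by rewrite linearB /= linearZ /= trmx_mul trmxK sD.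
  (* For given [v] this first coordinate minimises the quadratic form; it annihilates the leading
     block of the product and leaves the Schur complement evaluated at [v]. *)
  move=> v v0; have := pH (row_mx (- a^-1 *: (v *m b^T)) v) _.
  rewrite HE mul_row_block tr_row_mx mul_row_col.
  have -> : (- a^-1 *: (v *m b^T) *m a%:M + v *m b^T) = 0.
    by rewrite mul_mx_scalar scalerA mulrN divff // scaleN1r addNr.
  rewrite mul0mx add0r => /(_ _)/wrap[|].
    apply: contra v0 => /eqP/(congr1 (@rsubmx _ _ _ _)).
    by rewrite row_mxKr linear0 => ->.
  have -> // : v *m (D - a^-1 *: (b^T *m b)) = - a^-1 *: (v *m b^T) *m b + v *m D.
  by rewrite mulmxBr -scalemxAr -scalemxAl scaleNr mulmxA addrC.
pose T : 'M[R]_(1 + n) := block_mx (Num.sqrt a)%:M 0 ((Num.sqrt a)^-1 *: b^T) S.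
exists T.
  rewrite [T \in _]unitmxE (_ : \det T = Num.sqrt a * \det S).
    by rewrite unitrM unitfE sa0 -[_ \is a _]unitmxE.
  by rewrite [LHS](@det_lblock _ 1 n) det_scalar1.
suff : H = T *m T^T by [].
rewrite /T tr_block_mx mulmx_block tr_scalar_mx !trmx0 HE.
rewrite !mul0mx !mulmx0 !addr0 -scalar_mxM sa2; congr block_mx.
- by rewrite linearZ /= trmxK mul_scalar_mx scalerA divff ?scale1r.
- by rewrite mul_mx_scalar scalerA divff ?scale1r.
- rewrite linearZ /= trmxK -scalemxAl -scalemxAr scalerA -invfM sa2 -DE.
  by rewrite addrC subrK.
Qed.

(** The hypothesis says that [A], acting on row vectors, is skew for the inner product with Gram
    matrix $SS^T$; conjugation by [S] rewrites it in an orthonormal basis. *)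
Lemma skew_conj n (S A : 'M[R]_n) : S \in unitmx ->
  A *m (S *m S^T) + (S *m S^T) *m A^T = 0 -> skew (invmx S *m A *m S).
Proof.
move=> uS E; have uT : S^T \in unitmx by rewrite unitmx_tr.
have {}E : A *m S = - (S *m S^T *m A^T *m invmx S^T).
  rewrite -[LHS](mulmxK uT) -mulNmx; congr (_ *m _).
  by apply/eqP; rewrite -addr_eq0 -(mulmxA A) E.
have K : invmx S *m A *m S = - (S^T *m A^T *m invmx S^T).
  by rewrite -mulmxA E mulmxN !mulmxA mulVmx // mul1mx.
by rewrite /skew [in RHS]K opprK !trmx_mul trmx_inv mulmxA.
Qed.

Lemma frob2_skew n (A : 'M[R]_n) : skew A -> frob2 A = - \tr (A *m A).
Proof. by move=> sA; rewrite /frob2 /frob sA mulmxN linearN. Qed.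

Lemma mxtrace_conj n (S A : 'M[R]_n) : S \in unitmx ->
  \tr (invmx S *m A *m S) = \tr A.
Proof. by move=> uS; rewrite mxtrace_mulC mulmxA mulmxV // mul1mx. Qed.

Lemma mulmx_conj n (S A B : 'M[R]_n) : S \in unitmx ->
  (invmx S *m A *m S) *m (invmx S *m B *m S) = invmx S *m (A *m B) *m S.
Proof. by move=> uS; rewrite !mulmxA mulmxK. Qed.

Lemma mxtrace_sqr_le0 n (H A : 'M[R]_n) : posdef H ->
  A *m H + H *m A^T = 0 -> \tr (A *m A) <= 0.
Proof.
move=> /cholesky[S uS ->] /(skew_conj uS) sA.
rewrite -(mxtrace_conj _ uS) -mulmx_conj // -oppr_ge0 -frob2_skew //.
exact: frob2_ge0.
Qed.

Lemma mxtrace_sqr_eq0 n (H A : 'M[R]_n) : posdef H ->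
  A *m H + H *m A^T = 0 -> \tr (A *m A) = 0 -> A = 0.
Proof.
move=> /cholesky[S uS ->] /(skew_conj uS) sA.
rewrite -(mxtrace_conj _ uS) -mulmx_conj // => /eqP.
rewrite -oppr_eq0 -frob2_skew // frob2_eq0 => /eqP E.
apply: (can_inj (mulKmx (_ : invmx S \in unitmx))); first by rewrite unitmx_inv.
by apply: (can_inj (mulmxK uS)); rewrite E mulmx0 mul0mx.
Qed.

Lemma sum_mxtrace_comm_le n r (H : 'M[R]_r) (F : 'I_n -> 'I_n -> 'M[R]_r) :
  posdef H -> (forall i j, F i j *m H + H *m (F i j)^T = 0) ->
  let u := - \sum_i \sum_j \tr (F i j *m F i j) in
  u <= 9 / 64 ->
  - (4 * \sum_i \sum_j \sum_k
      \tr ((F k i *m F k j - F k j *m F k i) *m F i j)) <= 19 / 10 * u.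
Proof.
move=> /cholesky[S uS ->] FS u u_le.
pose G i j := invmx S *m F i j *m S.
have sG i j : skew (G i j) by apply: skew_conj.
have uE : u = \sum_i \sum_j frob2 (G i j).
  rewrite /u -sumrN; apply: eq_bigr => i _; rewrite -sumrN; apply: eq_bigr => j _.
  by rewrite frob2_skew // mulmx_conj // mxtrace_conj.
have u0 : 0 <= u.
  by rewrite uE; do 2![apply: sumr_ge0 => ? _]; exact: frob2_ge0.
have := sum_mxtrace3_skew sG; rewrite -uE.
have -> : \sum_i \sum_j \sum_k 2 * \tr (G k i *m G k j *m G i j)
    = \sum_i \sum_j \sum_k \tr ((F k i *m F k j - F k j *m F k i) *m F i j).
  apply: eq_bigr => i _; apply: eq_bigr => j _; apply: eq_bigr => k _.
  rewrite -mxtrace_comm_skew // !mulmx_conj // -mulmxBl -mulmxBr.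
  by rewrite !mulmx_conj // mxtrace_conj.
set T := \sum_i _ => T2.
(* The constant is $16\cdot\frac85\cdot\frac9{64}=\frac{18}5$, just below
   $(\frac{19}{10})^2=\frac{361}{100}$; here $9/64=(3/8)^2$ bounds one factor of [u]. *)
have : (4 * T) ^+ 2 <= (19 / 10 * u) ^+ 2.
  have : u ^+ 3 <= 9 / 64 * u ^+ 2 by rewrite exprS; apply: ler_wpM2r; rewrite ?sqr_ge0.
  have := sqr_ge0 u; rewrite !exprMn; lra.
rewrite -subr_ge0 subr_sqr => H19.
have [//|lt19] := leP (- (4 * T)) (19 / 10 * u).
have : (19 / 10 * u - 4 * T) * (19 / 10 * u + 4 * T) < 0.
  by rewrite pmulr_rlt0; lra.
lra.
Qed.

End Cholesky.
(** * Smooth functions *)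

Section LineDerivative.
Variables (R : realType) (V : normedModType R).

Lemma is_derive_line (f : V -> R) (x v : V) (t : R) :
  derivable f (x + t *: v) v ->
  is_derive t 1 (fun s : R => f (x + s *: v)) ('D_v f (x + t *: v)).
Proof.
move=> df.
have E : (fun h : R => h^-1 *: (f (x + (h *: (1 : R) + t) *: v) - f (x + t *: v)))
    = (fun h : R => h^-1 *: (f (h *: v + (x + t *: v)) - f (x + t *: v))).
  apply/funext => h; congr (_ *: (f _ - _)).
  by rewrite scalerDl addrCA -[h *: (1 : R)]/(h * 1) mulr1.
by apply: DeriveDef; rewrite /derivable /derive /= E.
Qed.

Lemma is_derive_translate (f : V -> R) (x a v : V) : derivable f (x + a) v ->
  is_derive x v (fun y => f (y + a)) ('D_v f (x + a)).
Proof.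
move=> df.
have E : (fun h : R => h^-1 *: (f (h *: v + x + a) - f (x + a)))
    = (fun h : R => h^-1 *: (f (h *: v + (x + a)) - f (x + a))).
  by apply/funext => h; rewrite addrA.
by split; rewrite /derivable /derive /= E.
Qed.

Lemma line_MVT (f : V -> R) (x v : V) (h : R) : 0 < h ->
  (forall t, 0 <= t <= h -> derivable f (x + t *: v) v) ->
  exists2 s : R, 0 < s <= h & f (x + h *: v) - f x = 'D_v f (x + s *: v) * h.
Proof.
move=> h0 df; pose g (t : R) := f (x + t *: v).
have dg t : t \in `[0, h] -> is_derive t 1 g ('D_v f (x + t *: v)).
  by rewrite in_itv => th; apply: is_derive_line; exact: df.
pose dfg (t : R) := 'D_v f (x + t *: v).
have dgo t : t \in `]0, h[ -> is_derive t 1 g (dfg t).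
  by move=> th; apply: dg; apply: subset_itv_oo_cc th.
have cg : {within `[0, h], continuous g}.
  by apply: derivable_within_continuous => t /dg dgt; exact: @ex_derive dgt.
have [s sh] := MVT h0 dgo cg.
rewrite /g scale0r addr0 subr0 => E; exists s => //.
by move: sh; rewrite in_itv /= => /andP[-> /ltW].
Qed.

Lemma nbhs_parallelogram (x v w : V) (P : set V) : nbhs x P ->
  exists2 d : R, 0 < d & forall s t, 0 <= s <= d -> 0 <= t <= d ->
    P (x + s *: v + t *: w).
Proof.
move=> /nbhs_ballP[e /= e0 eP].
have k0 : 0 < `|v| + `|w| + 1 by rewrite ltr_wpDl // addr_ge0.
exists (e / 2 / (`|v| + `|w| + 1)); first by rewrite !divr_gt0.
set d := _ / _ => s t /andP[s0 sd] /andP[t0 td]; apply: eP.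
rewrite -ball_normE /= -addrA opprD addNKr normrN.
apply: (le_lt_trans (ler_normD _ _)); rewrite !normrZ !ger0_norm //.
have d0 : 0 <= d by apply: le_trans sd.
have : d * (`|v| + `|w| + 1) = e / 2 by rewrite /d mulfVK // gt_eqF.
have : s * `|v| <= d * `|v| by rewrite ler_wpM2r.
have : t * `|w| <= d * `|w| by rewrite ler_wpM2r.
lra.
Qed.

End LineDerivative.

(** * Calculus of [Ck] maps and symmetry of second derivatives *)

Section Ck.
Variables (R : realType) (n : nat).
Implicit Types (U : set 'rV[R]_n) (V : normedModType R).

Definition pd V (i : 'I_n) (f : 'rV[R]_n -> V) (x : 'rV[R]_n) : V :=
  'D_(ebase R i) f x.

Lemma near_open U x (P : 'rV[R]_n -> Prop) : open U -> U x ->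
  (forall y, U y -> P y) -> \forall y \near x, P y.
Proof. by move=> oU Ux H; apply: filterS H _; exact: open_nbhs_nbhs. Qed.

Lemma CkW V k U (f : 'rV[R]_n -> V) : Ck k.+1 U f -> Ck k U f.
Proof.
elim: k f => [|k IH] f [cf df] //=; split=> // i.
by have [di Hi] := df i; split=> //; exact: IH.
Qed.

Lemma Ck_sub V k U U' (f : 'rV[R]_n -> V) : U' `<=` U -> Ck k U f -> Ck k U' f.
Proof.
move=> sU; elim: k f => [|k IH] f /=; first by move=> H x /sU; exact: H.
move=> [cf df]; split=> [x /sU|i]; first exact: cf.
have [di Hi] := df i; split=> [x /sU|]; [exact: di|exact: IH].
Qed.

Lemma eq_in_pd V U (f g : 'rV[R]_n -> V) i x : open U -> U x ->
  (forall y, U y -> f y = g y) -> pd i f x = pd i g x.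
Proof. by move=> oU Ux fg; apply: near_eq_derive; exact: near_open oU Ux fg. Qed.

Lemma eq_in_continuous_at V U (f g : 'rV[R]_n -> V) x : open U -> U x ->
  (forall y, U y -> f y = g y) -> {for x, continuous f} -> {for x, continuous g}.
Proof.
move=> oU Ux fg cf; change (g @ x --> g x); rewrite -(fg x Ux).
exact: cvg_trans (near_eq_cvg (near_open oU Ux fg)) cf.
Qed.

Lemma eq_in_Ck V k U (f g : 'rV[R]_n -> V) : open U ->
  (forall y, U y -> f y = g y) -> Ck k U f -> Ck k U g.
Proof.
move=> oU; elim: k f g => [|k IH] f g fg /=.
  by move=> cf x Ux; apply: eq_in_continuous_at oU Ux fg (cf x Ux).
move=> [cf df]; split=> [x Ux|i].
  by apply: eq_in_continuous_at oU Ux fg (cf x Ux).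
have [di Hi] := df i; split=> [x Ux|].
  exact: near_eq_derivable (near_open oU Ux fg) (di x Ux).
by apply: IH _ Hi => x Ux; exact: eq_in_pd oU Ux fg.
Qed.

Lemma Ck_cst V k U (c : V) : Ck k U (fun=> c).
Proof.
elim: k c => [|k IH] c /=; first by move=> x _; exact: cst_continuous.
split=> [x _|i]; first exact: cst_continuous.
split=> [x _|]; first exact: derivable_cst.
have -> : (fun x => 'D_(ebase R i) (fun=> c) x) = (fun=> 0).
  by apply/funext => x; rewrite derive_cst.
exact: IH.
Qed.

Lemma CkD V k U (f g : 'rV[R]_n -> V) : open U ->
  Ck k U f -> Ck k U g -> Ck k U (fun x => f x + g x).
Proof.
move=> oU; elim: k f g => [|k IH] f g /=.
  by move=> cf cg x Ux; exact: (cvgD (cf x Ux) (cg x Ux)).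
move=> [cf df] [cg dg]; split=> [x Ux|i].
  exact: (cvgD (cf x Ux) (cg x Ux)).
have [di Hi] := df i; have [ei Gi] := dg i; split=> [x Ux|].
  exact: (derivableD (di x Ux) (ei x Ux)).
apply: eq_in_Ck (IH _ _ Hi Gi) => // x Ux.
by symmetry; exact: deriveD (di x Ux) (ei x Ux).
Qed.

Lemma CkM k U (f g : 'rV[R]_n -> R) : open U ->
  Ck k U f -> Ck k U g -> Ck k U (fun x => f x * g x : R).
Proof.
move=> oU; elim: k f g => [|k IH] f g.
  by move=> cf cg x Ux; exact: (cvgM (cf x Ux) (cg x Ux)).
move=> Hf Hg; have := CkW Hf; have := CkW Hg.
case: Hf => cf df; case: Hg => cg dg Hg Hf; split=> [x Ux|i].
  exact: (cvgM (cf x Ux) (cg x Ux)).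
have [di Hi] := df i; have [ei Gi] := dg i; split=> [x Ux|].
  exact: (derivableM (di x Ux) (ei x Ux)).
apply: eq_in_Ck (CkD oU (IH _ _ Hf Gi) (IH _ _ Hg Hi)) => // x Ux.
by symmetry; exact: deriveM (di x Ux) (ei x Ux).
Qed.

Lemma derive_coord (j : 'I_n) (x v : 'rV[R]_n) :
  is_derive x v (fun y : 'rV[R]_n => y 0 j : R) (v 0 j).
Proof.
have did : derivable (@id 'rV[R]_n) x v by exact: derivable_id.
split; first by move/derivable_mxP : did => /(_ 0 j).
by have := derive_mx did; rewrite derive_id => /matrixP/(_ 0 j) ->; rewrite mxE.
Qed.

Lemma Ck_coord k U (j : 'I_n) : Ck k U (fun x : 'rV[R]_n => x 0 j : R).
Proof.
case: k => [|k] /=; first by move=> x _; exact: coord_continuous.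
split=> [x _|i]; first exact: coord_continuous.
split=> [x _|]; first by have [] := derive_coord j x (ebase R i).
have -> : (fun x => 'D_(ebase R i) (fun y : 'rV[R]_n => y 0 j : R) x)
    = (fun=> ebase R i 0 j).
  by apply/funext => x; have [] := derive_coord j x (ebase R i).
exact: Ck_cst.
Qed.

Lemma continuous_mxP m p (F : 'rV[R]_n -> 'M[R]_(m, p)) x :
  {for x, continuous F} <-> forall i j, {for x, continuous (fun y => F y i j : R)}.
Proof.
split=> [cF i j|cF].
  exact: (@continuous_comp _ _ _ F (fun M : 'M[R]_(m, p) => M i j : R) x cF
           (@coord_continuous R m p i j (F x))).
have FF : Filter (nbhs x) by exact: nbhs_filter.
apply/(@cvgrPdist_lt R _ _ (nbhs x) FF F (F x)) => e e0; near=> y.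
rewrite /Num.Def.normr/= mx_normrE; apply/bigmax_ltP; split=> // -[i j] _.
rewrite !mxE /=.
move: i j; near: y; apply: filter_forall => i; apply: filter_forall => j.
by move: (cF i j) => /cvgrPdist_lt; apply.
Unshelve. all: by end_near. Qed.

Lemma Ck_mxP m p k U (F : 'rV[R]_n -> 'M[R]_(m, p)) : open U ->
  Ck k U F <-> forall i j, Ck k U (fun x => F x i j : R).
Proof.
move=> oU; elim: k F => [|k IH] F /=.
  split=> [cF i j x /cF /continuous_mxP|cF x Ux]; first exact.
  by apply/continuous_mxP => i j; exact: cF.
split=> [[cF dF] i j|H].
  split=> [x /cF /continuous_mxP|l]; first exact.
  have [dl Hl] := dF l; split=> [x /dl /derivable_mxP|]; first exact.
  have /IH /(_ i j) := Hl; apply: eq_in_Ck => // x Ux.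
  by rewrite derive_mx ?mxE //; exact: dl.
split=> [x Ux|l]; first by apply/continuous_mxP => i j; have [c _] := H i j; exact: c.
have dl x : U x -> derivable F x (ebase R l).
  by move=> Ux; apply/derivable_mxP => i j; have [_ /(_ l)[d _]] := H i j; exact: d.
split=> //; apply/IH => i j; have [_ /(_ l)[_]] := H i j.
by apply: eq_in_Ck => // x Ux; rewrite derive_mx ?mxE //; exact: dl.
Qed.

(* Both mixed derivatives are limits of the same second difference quotient. *)
Lemma pdC U (f : 'rV[R]_n -> R) i j x : open U -> Ck 2 U f -> U x ->
  pd i (pd j f) x = pd j (pd i f) x.
Proof.
move=> oU [_ d1] Ux.
have D1 l y : U y -> derivable f y (ebase R l) by have [d _] := d1 l; exact: d.
have D2 l l' y : U y -> derivable (pd l f) y (ebase R l').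
  by have [_ [_ /(_ l')[d _]]] := d1 l; exact: d.
have C2 l l' y : U y -> {for y, continuous (pd l' (pd l f))}.
  by have [_ [_ /(_ l')[_ c]]] := d1 l; exact: c.
have key l l' (e : R) : 0 < e -> exists2 d : R, 0 < d & forall h : R, 0 < h <= d ->
    `|(f (x + h *: ebase R l + h *: ebase R l') - f (x + h *: ebase R l)
      - f (x + h *: ebase R l') + f x) / h ^+ 2 - pd l' (pd l f) x| < e.
  move=> e0; set v := ebase R l; set w := ebase R l'.
  have nU : nbhs x U by exact: open_nbhs_nbhs.
  have nC : \forall y \near x, `|pd l' (pd l f) y - pd l' (pd l f) x| < e.
    have FF : Filter (nbhs x) by exact: nbhs_filter.
    have cf : pd l' (pd l f) @ x --> pd l' (pd l f) x := C2 l l' x Ux.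
    have := (@cvgrPdist_lt R _ _ (nbhs x) FF _ _).1 cf e e0.
    apply: (@filterS _ (nbhs x) FF) => y /=.
    by move=> H; rewrite (distrC _ (pd l' (pd l f) x)); exact: H.
  have [d d0 H] := nbhs_parallelogram v w (filterI nU nC).
  have zero_in (c : R) : 0 < c -> 0 <= (0 : R) <= c by move=> /ltW ->; rewrite lexx.
  exists d => // h /andP[h0 hd].
  have h0d : 0 <= h <= d by rewrite ltW.
  have shd s : 0 <= s <= h -> 0 <= s <= d.
    by move=> /andP[-> sh]; rewrite (le_trans sh).
  (* The mean value theorem is applied along [v] to the increment [g], then along [w] to the
     derivative of [f] along [v]; the second difference becomes $h^2$ times a mixed derivative at a
     nearby point. *)
  pose g y := f (y + h *: w) - f y.
  have dg t (th : 0 <= t <= h) : is_derive (x + t *: v) v g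
      (pd l f (x + t *: v + h *: w) - pd l f (x + t *: v)).
    have [Ut _] := H t h (shd t th) h0d.
    have [Ut0 _] := H t 0 (shd t th) (zero_in d d0).
    rewrite scale0r addr0 in Ut0.
    have d1' := is_derive_translate (D1 l _ Ut).
    have d2 := derivableP (D1 l _ Ut0).
    exact: is_deriveB.
  have [|s sh0 E] := @line_MVT _ _ g x v h h0; first by move=> t /dg[].
  have sh : 0 <= s <= h by case/andP: sh0 => /ltW -> ->.
  have [|r rh0 E'] := @line_MVT _ _ (pd l f) (x + s *: v) w h h0.
    by move=> t th; apply: D2; have [] := H s t (shd _ sh) (shd _ th).
  have rh : 0 <= r <= h by case/andP: rh0 => /ltW -> ->.
  have [_ gE] := dg s sh; move: E; rewrite gE E' /g => E.
  have [_] := H s r (shd _ sh) (shd _ rh); congr (`| _ - _ | < _).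
  have h_neq0 : h != 0 by rewrite gt_eqF.
  apply: (canRL (mulfK _)); first by rewrite expf_neq0.
  set D := pd l' (pd l f) _.
  have -> : D * h ^+ 2 = D * h * h by rewrite expr2 mulrA.
  rewrite -[D * h * h]E; ring.
apply/eqP; rewrite -subr_eq0 -normr_le0; apply/ler_addgt0Pr => e e0; rewrite add0r.
have e20 : 0 < e / 2 by rewrite divr_gt0.
have [d d0 Hd] := key i j _ e20; have [d' d'0 Hd'] := key j i _ e20.
have [m m0 [md md']] : exists2 m : R, 0 < m & m <= d /\ m <= d'.
  by exists (Num.min d d'); rewrite ?lt_min ?d0 // !ge_min !lexx orbT.
have h1 : `|_ - pd j (pd i f) x| < _ := Hd m (introT andP (conj m0 md)).
have h2 : `|_ - pd i (pd j f) x| < _ := Hd' m (introT andP (conj m0 md')).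
have swap (a b c a' : R) : a - b - c + a' = a - c - b + a' by rewrite (addrAC a).
rewrite (addrAC x (m *: ebase R j)) [X in X / _]swap in h2.
set q := _ / _ in h1; rewrite -/q in h2.
have sub2 (a b c : R) : b - a = (c - a) - (c - b) by ring.
rewrite (sub2 _ _ q).
apply: le_trans (ler_normB _ _) _; rewrite [e]splitr.
exact: lerD (ltW h1) (ltW h2).
Qed.

End Ck.

(** * Derivatives at a maximum, and differentiation rules for smooth maps *)

Section Smooth.
Variables (R : realType) (n : nat).
Implicit Types (U : set 'rV[R]_n) (V : normedModType R).

Lemma pd_max U (f : 'rV[R]_n -> R) i x : open U -> U x -> Ck 2 U f ->
  (forall y, U y -> f y <= f x) ->
  pd i f x = 0 /\ pd i (pd i f) x <= 0.
Proof.
move=> oU Ux [_ /(_ i)[D1 [_ /(_ i)[D2 C2]]]] fmax.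
set v := ebase R i in D1 D2 C2 *.
have nU : nbhs x U by exact: open_nbhs_nbhs.
have f'0 : pd i f x = 0.
  (* The second side [- v] turns nonnegative parameters into a segment on both sides of [x], as an
     interior maximum requires. *)
  have [d d0 H] := nbhs_parallelogram v (- v) nU.
  have Ht (t : R) : t \in `]- d, d[ -> U (x + t *: v).
    rewrite in_itv /= => /andP[td dt]; have [t0|/ltW t0] := leP 0 t.
      have := H t 0; rewrite scale0r addr0; apply; first by rewrite t0 ltW.
      by rewrite lexx ltW.
    have := H 0 (- t); rewrite scale0r addr0 scalerN scaleNr opprK; apply.
      by rewrite lexx ltW.
    by rewrite oppr_ge0 t0 lerNl ltW.
  have dd : - d <= d by rewrite (@le_trans _ _ 0) ?oppr_le0 // ltW.
  have d00 : 0 \in `]- d, d[ by rewrite in_itv /= oppr_lt0 d0.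
  have dg (t : R) : t \in `]- d, d[ -> derivable (fun s : R => f (x + s *: v)) t 1.
    by move=> /Ht /D1 /is_derive_line[].
  have gm (t : R) : t \in `]- d, d[ -> f (x + t *: v) <= f (x + 0 *: v).
    by move=> /Ht /fmax; rewrite scale0r addr0.
  have [_ E] := derive1_at_max dd dg d00 gm.
  have [_] := is_derive_line (D1 _ (Ht 0 d00)).
  by rewrite E scale0r addr0.
(* A positive second derivative stays positive near [x]. Since the first derivative vanishes at [x],
   two mean value steps push [f] above [f x] at [x + d *: v]. *)
split=> //; rewrite leNgt; apply/negP => b0.
have FF : Filter (nbhs x) by exact: nbhs_filter.
have cf : pd i (pd i f) @ x --> pd i (pd i f) x := C2 x Ux.
have nC : nbhs x [set y | 0 < pd i (pd i f) y].
  have := (@cvgrPdist_lt R _ _ (nbhs x) FF _ _).1 cf _ b0.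
  apply: (@filterS _ (nbhs x) FF) => y /= H.
  have := le_lt_trans (ler_norm _) H.
  by rewrite ltrBlDr ltrDl.
have [d d0 H] := nbhs_parallelogram v v (filterI nU nC).
have dd : 0 <= d by exact: ltW.
have Ht (t : R) : 0 <= t <= d -> U (x + t *: v) /\ 0 < pd i (pd i f) (x + t *: v).
  by move=> td; have := H t 0 td; rewrite scale0r addr0 lexx; apply.
have [t td|s /andP[s0 sd] E] := @line_MVT _ _ f x v d d0.
  by apply: D1; have [] := Ht t td.
have [t /andP[t0 ts]|r /andP[r0 rs] E'] := @line_MVT _ _ (pd i f) x v s s0.
  by apply: D2; have [] := Ht t; rewrite ?t0 ?(le_trans ts).
have [_ p0] : U (x + r *: v) /\ 0 < pd i (pd i f) (x + r *: v).
  by apply: Ht; rewrite (ltW r0) (le_trans rs).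
have [Ud _] : U (x + d *: v) /\ 0 < pd i (pd i f) (x + d *: v).
  by apply: Ht; rewrite dd lexx.
have pos : 0 < pd i f (x + s *: v).
  by move: E'; rewrite f'0 subr0 => ->; exact: mulr_gt0.
have := fmax _ Ud; rewrite -subr_le0 E pmulr_lle0 //; apply/negP; rewrite -ltNge.
exact: pos.
Qed.

(** Every clause of [Ck] is a condition at a single point on [f] and its iterated derivatives, so it
    can be checked on a cover. This lets [u] be proved smooth chart by chart. *)
Lemma Ck_local V k U (f : 'rV[R]_n -> V) :
  (forall x, U x -> exists2 W, W x & Ck k W f) -> Ck k U f.
Proof.
elim: k f => [|k IH] f H; first by move=> x /H[W Wx cf]; exact: cf.
split=> [x /H[W Wx [cf _]]|i]; first exact: cf.
split=> [x /H[W Wx [_ /(_ i)[df _]]]|]; first exact: df.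
by apply: IH => x /H[W Wx [_ /(_ i)[_ Hf]]]; exists W.
Qed.

Lemma smooth_local V U (f : 'rV[R]_n -> V) :
  (forall x, U x -> exists2 W, W x & smooth W f) -> smooth U f.
Proof. by move=> H k; apply: Ck_local => x /H[W Wx sf]; exists W. Qed.

Lemma smooth_sub V U U' (f : 'rV[R]_n -> V) : U' `<=` U -> smooth U f -> smooth U' f.
Proof. by move=> sU sf k; exact: Ck_sub (sf k). Qed.

Lemma eq_in_smooth V U (f g : 'rV[R]_n -> V) : open U ->
  (forall y, U y -> f y = g y) -> smooth U f -> smooth U g.
Proof. by move=> oU fg sf k; exact: eq_in_Ck (sf k). Qed.

Lemma smooth_cst V U (c : V) : smooth U (fun=> c).
Proof. by move=> k; exact: Ck_cst. Qed.

Lemma smooth_coord U (j : 'I_n) : smooth U (fun x : 'rV[R]_n => x 0 j : R).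
Proof. by move=> k; exact: Ck_coord. Qed.

Lemma smoothD V U (f g : 'rV[R]_n -> V) : open U ->
  smooth U f -> smooth U g -> smooth U (fun x => f x + g x).
Proof. by move=> oU sf sg k; exact: CkD. Qed.

Lemma smoothM U (f g : 'rV[R]_n -> R) : open U ->
  smooth U f -> smooth U g -> smooth U (fun x => f x * g x : R).
Proof. by move=> oU sf sg k; exact: CkM. Qed.

Lemma smooth_mxP m p U (F : 'rV[R]_n -> 'M[R]_(m, p)) : open U ->
  smooth U F <-> forall i j, smooth U (fun x => F x i j : R).
Proof.
move=> oU; split=> [sF i j k|sF k]; first exact: (Ck_mxP k F oU).1 (sF k) i j.
by apply/(Ck_mxP k F oU) => i j; exact: sF.
Qed.

Lemma smooth_sum V (I : Type) (r : seq I) U (f : I -> 'rV[R]_n -> V) : open U ->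
  (forall i, smooth U (f i)) -> smooth U (fun x => \sum_(i <- r) f i x).
Proof.
move=> oU sf; elim: r => [|i r IH].
  by apply: eq_in_smooth (smooth_cst U 0) => // y _; rewrite big_nil.
by apply: eq_in_smooth (smoothD oU (sf i) IH) => // y _; rewrite big_cons.
Qed.

Lemma smoothZ m p U (f : 'rV[R]_n -> R) (F : 'rV[R]_n -> 'M[R]_(m, p)) : open U ->
  smooth U f -> smooth U F -> smooth U (fun x => f x *: F x).
Proof.
move=> oU sf /(smooth_mxP _ oU) sF; apply/(smooth_mxP _ oU) => i j.
by apply: eq_in_smooth (smoothM oU sf (sF i j)) => // y _; rewrite mxE.
Qed.

Lemma smoothN m p U (F : 'rV[R]_n -> 'M[R]_(m, p)) : open U ->
  smooth U F -> smooth U (fun x => - F x).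
Proof.
move=> oU sF; apply: eq_in_smooth (smoothZ oU (smooth_cst U (- 1 : R)) sF) => //.
by move=> y _; rewrite scaleN1r.
Qed.

Lemma smoothB m p U (F G : 'rV[R]_n -> 'M[R]_(m, p)) : open U ->
  smooth U F -> smooth U G -> smooth U (fun x => F x - G x).
Proof. by move=> oU sF sG; apply: smoothD => //; exact: smoothN. Qed.

Lemma smooth_mulmx m p q U (F : 'rV[R]_n -> 'M[R]_(m, p))
    (G : 'rV[R]_n -> 'M[R]_(p, q)) : open U ->
  smooth U F -> smooth U G -> smooth U (fun x => F x *m G x).
Proof.
move=> oU /(smooth_mxP _ oU) sF /(smooth_mxP _ oU) sG.
apply/(smooth_mxP _ oU) => i j.
apply: eq_in_smooth (@smooth_sum _ _ (index_enum 'I_p) U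
  (fun k x => F x i k * G x k j : R) oU (fun k => smoothM oU (sF i k) (sG k j))) => //.
by move=> y _; rewrite mxE.
Qed.

Lemma smooth_tr m p U (F : 'rV[R]_n -> 'M[R]_(m, p)) : open U ->
  smooth U F -> smooth U (fun x => (F x)^T).
Proof.
move=> oU /(smooth_mxP _ oU) sF; apply/(smooth_mxP _ oU) => i j.
by apply: eq_in_smooth (sF j i) => // y _; rewrite mxE.
Qed.

Lemma smooth_mxtrace m U (F : 'rV[R]_n -> 'M[R]_m) : open U ->
  smooth U F -> smooth U (fun x => \tr (F x) : R).
Proof.
by move=> oU /(smooth_mxP _ oU) sF; apply: (@smooth_sum _ _ _ U (fun i x => F x i i : R)).
Qed.

Lemma smooth_pd V U (f : 'rV[R]_n -> V) i : smooth U f -> smooth U (pd i f).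
Proof. by move=> sf k; have [_ /(_ i)[]] := sf k.+1. Qed.

Lemma smooth_derivable V U (f : 'rV[R]_n -> V) i x : smooth U f -> U x ->
  derivable f x (ebase R i).
Proof. by move=> /(_ 1%N)[_ /(_ i)[df _]]; exact: df. Qed.

Arguments smooth_derivable {V U f} i {x}.

Lemma pd_cst V (c : V) i x : pd i (fun _ : 'rV[R]_n => c) x = 0.
Proof. exact: derive_cst. Qed.

Lemma pd_coord i j (x : 'rV[R]_n) : pd i (fun y : 'rV[R]_n => y 0 j : R) x = (i == j)%:R.
Proof.
have [_] := derive_coord j x (ebase R i); rewrite /pd => ->.
by rewrite mxE /= eq_sym.
Qed.

Section Rules.
Variables (U : set 'rV[R]_n) (x : 'rV[R]_n) (i : 'I_n).
Hypothesis Ux : U x.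

Lemma pdD V (f g : 'rV[R]_n -> V) : smooth U f -> smooth U g ->
  pd i (fun y => f y + g y) x = pd i f x + pd i g x.
Proof.
move=> sf sg; rewrite /pd.
exact: deriveD (smooth_derivable i sf Ux) (smooth_derivable i sg Ux).
Qed.

Lemma pdN V (f : 'rV[R]_n -> V) : smooth U f ->
  pd i (fun y => - f y) x = - pd i f x.
Proof. by move=> sf; rewrite /pd; exact: deriveN (smooth_derivable i sf Ux). Qed.

Lemma pdB V (f g : 'rV[R]_n -> V) : smooth U f -> smooth U g ->
  pd i (fun y => f y - g y) x = pd i f x - pd i g x.
Proof.
move=> sf sg; rewrite /pd.
exact: deriveB (smooth_derivable i sf Ux) (smooth_derivable i sg Ux).
Qed.

Lemma pdM (f g : 'rV[R]_n -> R) : smooth U f -> smooth U g ->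
  pd i (fun y => f y * g y : R) x = pd i f x * g x + f x * pd i g x.
Proof.
move=> sf sg; rewrite addrC [pd i f x * _]mulrC.
rewrite /pd; exact: deriveM (smooth_derivable i sf Ux) (smooth_derivable i sg Ux).
Qed.

Lemma pd_mx m p (F : 'rV[R]_n -> 'M[R]_(m, p)) a b : smooth U F ->
  pd i F x a b = pd i (fun y => F y a b : R) x.
Proof.
by move=> sF; rewrite /pd derive_mx ?mxE //; exact: (smooth_derivable _ sF Ux).
Qed.

Lemma pd_tr m p (F : 'rV[R]_n -> 'M[R]_(m, p)) : open U -> smooth U F ->
  pd i (fun y => (F y)^T) x = (pd i F x)^T.
Proof.
move=> oU sF; apply/matrixP => a b; rewrite mxE !pd_mx //; last exact: smooth_tr.
by apply: eq_in_pd (oU) Ux _ => y _; rewrite mxE.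
Qed.

Lemma pd_sum V (I : Type) (r : seq I) (f : I -> 'rV[R]_n -> V) : open U ->
  (forall k, smooth U (f k)) ->
  pd i (fun y => \sum_(k <- r) f k y) x = \sum_(k <- r) pd i (f k) x.
Proof.
move=> oU sf; elim: r => [|k r IH].
  rewrite big_nil; apply: etrans (pd_cst (0 : V) i x); apply: eq_in_pd (oU) Ux _ => y _.
  by rewrite big_nil.
rewrite big_cons -IH -pdD //; last exact: smooth_sum.
by apply: eq_in_pd (oU) Ux _ => y _; rewrite big_cons.
Qed.

Lemma pd_mulmx m p q (F : 'rV[R]_n -> 'M[R]_(m, p)) (G : 'rV[R]_n -> 'M[R]_(p, q)) :
  open U -> smooth U F -> smooth U G ->
  pd i (fun y => F y *m G y) x = pd i F x *m G x + F x *m pd i G x.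
Proof.
move=> oU sF sG; have sFe := (smooth_mxP F oU).1 sF; have sGe := (smooth_mxP G oU).1 sG.
apply/matrixP => a b; rewrite pd_mx; last exact: smooth_mulmx.
have -> : pd i (fun y => (F y *m G y) a b : R) x
    = pd i (fun y => \sum_k F y a k * G y k b : R) x.
  by apply: eq_in_pd (oU) Ux _ => y _; rewrite mxE.
rewrite !mxE -big_split /= pd_sum //; last by move=> k; exact: smoothM.
by apply: eq_bigr => k _; rewrite pdM // !pd_mx.
Qed.

Lemma pdZ m p (f : 'rV[R]_n -> R) (F : 'rV[R]_n -> 'M[R]_(m, p)) :
  open U -> smooth U f -> smooth U F ->
  pd i (fun y => f y *: F y) x = pd i f x *: F x + f x *: pd i F x.
Proof.
move=> oU sf sF; have sFe := (smooth_mxP F oU).1 sF.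
apply/matrixP => a b; rewrite pd_mx; last exact: smoothZ.
have -> : pd i (fun y => (f y *: F y) a b : R) x = pd i (fun y => f y * F y a b : R) x.
  by apply: eq_in_pd (oU) Ux _ => y _; rewrite mxE.
by rewrite pdM // !mxE pd_mx.
Qed.

Lemma pd_mxtrace m (F : 'rV[R]_n -> 'M[R]_m) : open U -> smooth U F ->
  pd i (fun y => \tr (F y) : R) x = \tr (pd i F x).
Proof.
move=> oU sF; have sFe := (smooth_mxP F oU).1 sF.
by rewrite [LHS]pd_sum //; apply: eq_bigr => k _; rewrite pd_mx.
Qed.

End Rules.

Lemma pd_pd_mx U x i j m p (F : 'rV[R]_n -> 'M[R]_(m, p)) a b : open U -> U x ->
  smooth U F -> pd i (pd j F) x a b = pd i (pd j (fun y => F y a b : R)) x.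
Proof.
move=> oU Ux sF; apply: etrans (pd_mx i Ux a b (smooth_pd j sF)) _.
by apply: eq_in_pd oU Ux _ => y Uy; exact: (pd_mx j Uy a b sF).
Qed.

Lemma pdC_mx U x i j m p (F : 'rV[R]_n -> 'M[R]_(m, p)) : open U -> U x ->
  smooth U F -> pd i (pd j F) x = pd j (pd i F) x.
Proof.
move=> oU Ux sF; have sFe := (smooth_mxP F oU).1 sF.
apply/matrixP => a b.
have E k l : pd k (pd l F) x a b = pd k (pd l (fun y => F y a b : R)) x.
  exact: pd_pd_mx oU Ux sF.
exact: etrans (E i j) (etrans (pdC i j oU (sFe a b 2%N) Ux) (esym (E j i))).
Qed.

End Smooth.

(** * Maximum principle for the drift Laplacian *)

Section MaximumPrinciple.
Variables (R : realType) (n : nat).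

(* A maximum point of u - e |x|^2 exists because u is bounded. *)
Lemma bounded_subsolution_le0 (u : 'rV[R]_n -> R) (M c : R) :
  smooth setT u -> 0 < c -> (forall x, u x <= M) ->
  (forall x, c * u x <= \sum_i pd i (pd i u) x - \sum_i x 0 i / 2 * pd i u x) ->
  forall x, u x <= 0.
Proof.
move=> su c0 uM Lu x.
pose q (y : 'rV[R]_n) : R := \sum_j y 0 j * y 0 j.
have q0 y : 0 <= q y by apply: sumr_ge0 => j _; rewrite -expr2 sqr_ge0.
have sq : smooth setT q.
  apply: smooth_sum; first exact: openT.
  by move=> j; apply: smoothM; [exact: openT|exact: smooth_coord..].
(* For fixed [x] the right side is [e] times a constant, so small [e] will contradict [0 < u x]. *)
have key (e : R) : 0 < e -> c * u x <= e * (2 * n%:R + c * q x).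
  move=> e0; pose w y := u y + (- e) * q y.
  have seq : smooth setT (fun y => - e * q y : R).
    by apply: smoothM => //; [exact: openT|exact: smooth_cst].
  have sw : smooth setT w by apply: smoothD; [exact: openT| |].
  (* Outside the cube some $|y_j|>K\ge1$, so $|y|^2\ge y_j^2\ge|y_j|>K$ and $w(y)\le M-eK\le
     u(0)=w(0)$; hence the maximum over the cube is global. The lower bound 1 is what gives
     $y_j^2\ge|y_j|$. *)
  have [K K1 HK] : exists2 K : R, 1 <= K & M - u 0 <= e * K.
    exists (Num.max 1 ((M - u 0) / e)); first by rewrite le_max lexx.
    by rewrite mulrC -ler_pdivrMr // le_max lexx orbT.
  pose A := [set y : 'rV[R]_n | forall i, `[- K, K]%classic (y ord0 i)].
  have cA : compact A.
    exact: (@rV_compact R n (fun=> `[- K, K]%classic) (fun=> @segment_compact R _ _)).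
  have cw : {within A, continuous w}.
    by apply: continuous_subspaceT => y; exact: sw 0%N y I.
  have K0 : 0 <= K by apply: le_trans K1.
  have A0 : A 0 by move=> i; rewrite /= mxE in_itv /= K0 oppr_le0 K0.
  have [m /set_mem Am wmax] := EVT_max_rV (ex_intro _ 0 A0) cA cw.
  have wmaxT y : w y <= w m.
    have [Ay|nAy] := pselect (A y); first by apply: wmax; exact: mem_set.
    apply: le_trans (wmax 0 (mem_set A0)).
    have [j hj] : exists j, K < `|y 0 j|.
      apply: contrapT => H; apply: nAy => j /=; rewrite in_itv /= -ler_norml leNgt.
      by apply/negP => h; apply: H; exists j.
    have q00 : q 0 = 0 by rewrite /q big1 // => k _; rewrite mxE mul0r.
    have qy : K <= q y.
      apply: le_trans (_ : y 0 j * y 0 j <= _).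
        rewrite -expr2 -real_normK ?num_real // expr2.
        have y1 : 1 <= `|y 0 j| by apply: le_trans K1 (ltW hj).
        by apply: le_trans (ltW hj) _; rewrite ler_peMr.
      rewrite /q (bigD1 j) //= lerDl; apply: sumr_ge0 => k _.
      by rewrite -expr2 sqr_ge0.
    rewrite /w q00 mulr0 addr0; have := uM y.
    have : e * K <= e * q y by rewrite ler_wpM2l // ltW.
    by lra.
  have pdq i y : pd i q y = 2 * y 0 i.
    rewrite /q (@pd_sum _ _ setT) //; [|exact: openT|]; last first.
      by move=> j; apply: smoothM; [exact: openT|exact: smooth_coord..].
    rewrite (bigD1 i) //= big1 ?addr0 => [|j ji].
      rewrite (@pdM _ _ setT) ?pd_coord ?eqxx //; [|exact: smooth_coord..].
      by rewrite /= mulr1n mul1r mulr1 mulr_natl mulr2n.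
    rewrite (@pdM _ _ setT) ?pd_coord //; [|exact: smooth_coord..].
    by rewrite eq_sym (negPf ji) mul0r mulr0 addr0.
  have pdw i y : pd i w y = pd i u y + - e * (2 * y 0 i).
    rewrite /w (@pdD _ _ setT) // (@pdM _ _ setT) ?pd_cst ?pdq //; last exact: smooth_cst.
    by rewrite mul0r add0r.
  have pdpdw i : pd i (pd i w) m = pd i (pd i u) m - 2 * e.
    have s1 : smooth setT (fun y : 'rV[R]_n => - e * 2 * y 0 i : R).
      by apply: smoothM; [exact: openT|exact: smooth_cst|exact: smooth_coord].
    rewrite (@eq_in_pd _ _ _ setT _ (fun y => pd i u y + - e * 2 * y 0 i)) //;
      [|exact: openT|by move=> y _; rewrite pdw mulrA].
    rewrite (@pdD _ _ setT) //; last exact: smooth_pd.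
    rewrite (@pdM _ _ setT) ?pd_cst ?pd_coord ?eqxx //;
      [|exact: smooth_cst|exact: smooth_coord].
    by rewrite mul0r /= mulr1n; lra.
  have gm i : pd i w m = 0 /\ pd i (pd i w) m <= 0.
    exact: (pd_max i openT I (sw 2%N) (fun y _ => wmaxT y)).
  have lap : \sum_i pd i (pd i u) m <= e * (2 * n%:R).
    apply: le_trans (_ : \sum_(i < n) 2 * e <= _).
      by apply: ler_sum => i _; have [_] := gm i; rewrite pdpdw; lra.
    by rewrite sumr_const card_ord -mulr_natr; lra.
  (* At [m] the gradient of [u] is $2em$. The drift therefore contributes $-e|m|^2$ to $Lu$, which
     has the favourable sign. *)
  have drift : \sum_i m 0 i / 2 * pd i u m = e * q m.
    rewrite /q mulr_sumr; apply: eq_bigr => i _.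
    by have [+ _] := gm i; rewrite pdw => /eqP; rewrite addr_eq0 => /eqP ->; lra.
  have := Lu m; rewrite drift => Lm.
  have := wmaxT x; rewrite /w => wx.
  have : c * (u x + - e * q x) <= c * (u m + - e * q m) by rewrite ler_wpM2l // ltW.
  have eq0 := mulr_ge0 (ltW e0) (q0 m); have ceq0 := mulr_ge0 (ltW c0) eq0.
  move: lap Lm wx eq0 ceq0; move: (\sum_i _) (q m) (q x) (u m) (u x) => S qm qx um ux.
  by lra.
rewrite leNgt; apply/negP => ux0.
have cu : 0 < c * u x by exact: mulr_gt0.
have D0 : 0 < 2 * n%:R + c * q x + 1.
  by rewrite ltr_wpDl // addr_ge0 // ?mulr_ge0 ?ler0n // ltW.
(* With this [e] the right side of [key] is less than half of [c * u x]; the added 1 keeps the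
   denominator positive. *)
have := key (c * u x / 2 / (2 * n%:R + c * q x + 1)) _.
set D := 2 * n%:R + c * q x in D0 *; set t := c * u x in cu *.
rewrite !divr_gt0 // => /(_ isT).
have -> : t / 2 / (D + 1) * D = t / 2 - t / 2 / (D + 1).
  by field; rewrite gt_eqF.
have : 0 < t / 2 / (D + 1) by rewrite !divr_gt0.
lra.
Qed.

End MaximumPrinciple.
(** * Connections in a chart *)

Section MatrixRing.
Variables (R : comPzRingType).

Lemma addmxE m n (A B : 'M[R]_(m, n)) i j : (A + B) i j = A i j + B i j.
Proof. by rewrite mxE. Qed.

Lemma oppmxE m n (A : 'M[R]_(m, n)) i j : (- A) i j = - A i j.
Proof. by rewrite mxE. Qed.

End MatrixRing.

(* The [ring] tactic needs commutativity; after distributing the products, it is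
   applied entrywise, with the entries of the monomials as atoms. *)
Ltac mx_ring :=
  rewrite ?(mulmxDl, mulmxDr, mulNmx, mulmxN) ?mulmxA;
  apply/matrixP => ? ?; rewrite ?(addmxE, oppmxE); ring.

(** * Ricci, Bianchi and Bochner formulas for matrix connections *)

Section LocalGeometry.
Variables (R : realType) (n r : nat).
Variables (U : set 'rV[R]_n) (G : 'I_n -> 'rV[R]_n -> 'M[R]_r).

(* Coordinates of sections are row vectors, so that the connection is
   [s |-> d_i s + s *m G i] and endomorphisms compose in reverse order. *)
Definition curv i j x : 'M[R]_r :=
  pd i (G j) x - pd j (G i) x + G j x *m G i x - G i x *m G j x.

Definition nab i (M : 'rV[R]_n -> 'M[R]_r) x : 'M[R]_r :=
  pd i M x + M x *m G i x - G i x *m M x.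

Hypothesis oU : open U.
Hypothesis sG : forall i, smooth U (G i).

Lemma smooth_curv i j : smooth U (curv i j).
Proof.
apply: smoothB => //; last exact: smooth_mulmx.
apply: smoothD => //; last exact: smooth_mulmx.
by apply: smoothB => //; exact: smooth_pd.
Qed.

Lemma smooth_nab i (M : 'rV[R]_n -> 'M[R]_r) : smooth U M -> smooth U (nab i M).
Proof.
move=> sM; apply: smoothB => //; last exact: smooth_mulmx.
by apply: smoothD => //; [exact: smooth_pd|exact: smooth_mulmx].
Qed.

Lemma eq_in_nab i (M N : 'rV[R]_n -> 'M[R]_r) x : U x ->
  (forall y, U y -> M y = N y) -> nab i M x = nab i N x.
Proof. by move=> Ux MN; rewrite /nab (MN x Ux) (eq_in_pd i oU Ux MN). Qed.

Lemma nabD i (M N : 'rV[R]_n -> 'M[R]_r) x : U x -> smooth U M -> smooth U N ->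
  nab i (fun y => M y + N y) x = nab i M x + nab i N x.
Proof.
move=> Ux sM sN.
rewrite /nab (pdD i Ux sM sN).
by move: (pd i M x) (pd i N x) (M x) (N x) (G i x) => *; mx_ring.
Qed.

Lemma nabN i (M : 'rV[R]_n -> 'M[R]_r) x : U x ->
  smooth U M -> nab i (fun y => - M y) x = - nab i M x.
Proof.
move=> Ux sM.
rewrite /nab (pdN i Ux sM); move: (pd i M x) (M x) (G i x) => *; mx_ring.
Qed.

Lemma nabB i (M N : 'rV[R]_n -> 'M[R]_r) x : U x -> smooth U M -> smooth U N ->
  nab i (fun y => M y - N y) x = nab i M x - nab i N x.
Proof. by move=> Ux sM sN; rewrite nabD ?nabN //; exact: smoothN. Qed.

Lemma nabZ i (f : 'rV[R]_n -> R) (M : 'rV[R]_n -> 'M[R]_r) x : U x ->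
  smooth U f -> smooth U M ->
  nab i (fun y => f y *: M y) x = pd i f x *: M x + f x *: nab i M x.
Proof.
move=> Ux sf sM; rewrite /nab (pdZ i Ux oU sf sM).
by rewrite -scalemxAl -scalemxAr !scalerDr scalerN !addrA.
Qed.

Lemma nab_sum (I : Type) (s : seq I) i (M : I -> 'rV[R]_n -> 'M[R]_r) x : U x ->
  (forall k, smooth U (M k)) ->
  nab i (fun y => \sum_(k <- s) M k y) x = \sum_(k <- s) nab i (M k) x.
Proof.
move=> Ux sM; rewrite /nab (pd_sum i Ux s oU sM).
by rewrite mulmx_suml mulmx_sumr -big_split -sumrB.
Qed.

Lemma nab_comm_algebra (ddM dMi dMj M Gi Gj diGj djGi : 'M[R]_r) :
  (ddM + (dMi *m Gj + M *m diGj) - (diGj *m M + Gj *m dMi)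
     + (dMj + M *m Gj - Gj *m M) *m Gi - Gi *m (dMj + M *m Gj - Gj *m M))
  - (ddM + (dMj *m Gi + M *m djGi) - (djGi *m M + Gi *m dMj)
     + (dMi + M *m Gi - Gi *m M) *m Gj - Gj *m (dMi + M *m Gi - Gi *m M))
  = M *m (diGj - djGi + Gj *m Gi - Gi *m Gj)
    - (diGj - djGi + Gj *m Gi - Gi *m Gj) *m M.
Proof. by mx_ring. Qed.

Lemma pd_nab i j (M : 'rV[R]_n -> 'M[R]_r) x : U x -> smooth U M ->
  pd i (nab j M) x = pd i (pd j M) x + (pd i M x *m G j x + M x *m pd i (G j) x)
    - (pd i (G j) x *m M x + G j x *m pd i M x).
Proof.
move=> Ux sM; have sGj := sG j; have sdM := smooth_pd j sM.
have sMG := smooth_mulmx oU sM sGj; have sGM := smooth_mulmx oU sGj sM.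
rewrite [LHS](pdB i Ux (smoothD oU sdM sMG) sGM) (pdD i Ux sdM sMG).
by rewrite (pd_mulmx i Ux oU sM sGj) (pd_mulmx i Ux oU sGj sM).
Qed.

(** The Ricci identity on endomorphisms: second derivatives of [M] cancel by symmetry, and what
    remains is a commutator with the curvature, in the order dictated by row vectors. *)
Lemma nab_comm i j (M : 'rV[R]_n -> 'M[R]_r) x : U x -> smooth U M ->
  nab i (nab j M) x - nab j (nab i M) x = M x *m curv i j x - curv i j x *m M x.
Proof.
move=> Ux sM; rewrite [nab i _ _]/nab [nab j (nab i M) x]/nab !pd_nab //.
by rewrite (pdC_mx j i oU Ux sM) nab_comm_algebra.
Qed.

Lemma curv_antisym i j x : curv i j x = - curv j i x.
Proof.
rewrite /curv; move: (pd i (G j) x) (pd j (G i) x) (G i x) (G j x) => *; mx_ring.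
Qed.

Lemma pd_curv k i j x : U x ->
  pd k (curv i j) x = pd k (pd i (G j)) x - pd k (pd j (G i)) x
    + (pd k (G j) x *m G i x + G j x *m pd k (G i) x)
    - (pd k (G i) x *m G j x + G i x *m pd k (G j) x).
Proof.
move=> Ux; have sdj := smooth_pd i (sG j); have sdi := smooth_pd j (sG i).
have sji := smooth_mulmx oU (sG j) (sG i); have sij := smooth_mulmx oU (sG i) (sG j).
rewrite [LHS](pdB k Ux (smoothD oU (smoothB oU sdj sdi) sji) sij).
rewrite (pdD k Ux (smoothB oU sdj sdi) sji) (pdB k Ux sdj sdi).
by rewrite (pd_mulmx k Ux oU (sG j) (sG i)) (pd_mulmx k Ux oU (sG i) (sG j)).
Qed.

(** The second Bianchi identity, solved so that [k] is the first index of both curvatures on the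
    right; after another [nab k] and a sum over [k], divergences of the curvature can appear. *)
Lemma bianchi k i j x : U x ->
  nab k (curv i j) x = nab i (curv k j) x - nab j (curv k i) x.
Proof.
move=> Ux; rewrite /nab !pd_curv // /curv.
rewrite (pdC_mx k i oU Ux (sG j)) (pdC_mx k j oU Ux (sG i)) (pdC_mx j i oU Ux (sG k)).
move: (pd i (pd k (G j)) x) (pd j (pd k (G i)) x) (pd i (pd j (G k)) x).
move: (pd i (G j) x) (pd i (G k) x) (pd j (G i) x) (pd j (G k) x)
  (pd k (G i) x) (pd k (G j) x) (G i x) (G j x) (G k x) => *.
by mx_ring.
Qed.

Section Soliton.
Hypothesis soliton_eq : forall x j, U x ->
  \sum_i nab i (curv i j) x = \sum_i (x 0 i / 2) *: curv i j x.

Lemma bochner_algebra (S S1 S2 S3 S4 N C C' P Q : 'M[R]_r) :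
  S = S1 - S2 + S3 - S4 -> S1 = 2^-1 *: C + P -> S2 = 2^-1 *: C' + Q ->
  C' = - C -> N = P - Q -> S3 = - S4 -> S = C + N - 2 *: S4.
Proof.
move=> -> -> -> -> -> ->; by apply/matrixP => a b; rewrite !mxE; lra.
Qed.

(** In the differentiated soliton equation, the derivatives of the coefficient $x_k/2$ leave
    $\frac12F_{ij}$ and $-\frac12F_{ji}$, which add up to $F_{ij}$; Bianchi recombines the two drift
    sums into one; the two uses of the Ricci identity give the same commutator, whence the factor
    2. *)
Lemma bochner i j x : U x ->
  \sum_k nab k (nab k (curv i j)) x
    = curv i j x + \sum_k (x 0 k / 2) *: nab k (curv i j) x
      - 2 *: \sum_k (curv k i x *m curv k j x - curv k j x *m curv k i x).
Proof.
move=> Ux; have sc a b := smooth_curv a b.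
have sn k a b := smooth_nab k (sc a b).
have shalf (k : 'I_n) : smooth U (fun y : 'rV[R]_n => y 0 k / 2 : R).
  by apply: smoothM => //; [exact: smooth_coord|exact: smooth_cst].
have pdhalf a k : pd a (fun y : 'rV[R]_n => y 0 k / 2 : R) x = (a == k)%:R / 2.
  rewrite [LHS](pdM a Ux (@smooth_coord R n U k) (@smooth_cst R n _ U (2^-1 : R))).
  by rewrite (pd_coord a k x) (pd_cst (2^-1 : R) a x) mulr0 addr0.
have step k : nab k (nab k (curv i j)) x
    = nab i (nab k (curv k j)) x - nab j (nab k (curv k i)) x
      + (curv k j x *m curv k i x - curv k i x *m curv k j x)
      - (curv k i x *m curv k j x - curv k j x *m curv k i x).
  rewrite (@eq_in_nab k _ (fun y => nab i (curv k j) y - nab j (curv k i) y) x) //;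
    last by move=> y Uy; exact: bianchi.
  rewrite nabB // -(nab_comm k i Ux (sc k j)) -(nab_comm k j Ux (sc k i)).
  move: (nab i (nab k (curv k j)) x) (nab j (nab k (curv k i)) x).
  move: (nab k (nab i (curv k j)) x) (nab k (nab j (curv k i)) x) => A B C D.
  move: (curv k i x) (curv k j x) => X Y; mx_ring.
have dsol a b : \sum_k nab a (nab k (curv k b)) x
    = 2^-1 *: curv a b x + \sum_k (x 0 k / 2) *: nab a (curv k b) x.
  rewrite -nab_sum //.
  rewrite (@eq_in_nab a _ (fun y => \sum_k (y 0 k / 2) *: curv k b y) x) //; last first.
    by move=> y Uy; exact: soliton_eq.
  rewrite nab_sum //; last by move=> k; exact: smoothZ.
  rewrite (eq_bigr (fun k => ((a == k)%:R / 2) *: curv k b x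
     + (x 0 k / 2) *: nab a (curv k b) x)); last first.
    by move=> k _; rewrite nabZ // pdhalf.
  rewrite big_split /=; congr (_ + _).
  rewrite (bigD1 a) //= eqxx mulr1n mul1r big1 ?addr0 // => k ka.
  by rewrite eq_sym (negPf ka) mul0r scale0r.
have sum4 (X A B C D : 'I_n -> 'M[R]_r) :
    (forall k, X k = A k - B k + C k - D k) ->
    \sum_k X k = \sum_k A k - \sum_k B k + \sum_k C k - \sum_k D k.
  by move=> E; rewrite -!sumrB -big_split -sumrB; apply: eq_bigr => k _; exact: E.
have sumE :=
  (sum4 (fun k => nab k (nab k (curv i j)) x)
    (fun k => nab i (nab k (curv k j)) x) (fun k => nab j (nab k (curv k i)) x)
    (fun k => curv k j x *m curv k i x - curv k i x *m curv k j x)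
    (fun k => curv k i x *m curv k j x - curv k j x *m curv k i x) step).
have sum2 (A B C : 'I_n -> 'M[R]_r) (f : 'I_n -> R) : (forall k, A k = B k - C k) ->
    \sum_k f k *: A k = \sum_k f k *: B k - \sum_k f k *: C k.
  by move=> E; rewrite -sumrB; apply: eq_bigr => k _; rewrite E scalerBr.
have sumN (A B : 'I_n -> 'M[R]_r) : \sum_k (A k - B k) = - \sum_k (B k - A k).
  by rewrite -sumrN; apply: eq_bigr => k _; rewrite opprB.
exact: (bochner_algebra sumE (dsol i j) (dsol j i) (curv_antisym j i x)
  (sum2 _ _ _ (fun k => x 0 k / 2) (fun k => bianchi k i j Ux))
  (sumN (fun k => curv k j x *m curv k i x) (fun k => curv k i x *m curv k j x))).
Qed.

End Soliton.
End LocalGeometry.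

(** * Differential inequality for the squared curvature norm *)

Section DriftLaplacian.
Variables (R : realType) (n r : nat).

(** The inequality at one point, freed of analysis: [A k i j], [N k i j] and [xi k] stand for
    $\nabla_k\nabla_kF_{ij}$, $\nabla_kF_{ij}$ and $x_k/2$. The gradient term has a sign because
    each [N k i j] is skew for [H] too. *)
Lemma drift_laplacian_algebra (H : 'M[R]_r) (F : 'I_n -> 'I_n -> 'M[R]_r)
    (A N : 'I_n -> 'I_n -> 'I_n -> 'M[R]_r) (xi : 'I_n -> R) :
  posdef H ->
  (forall i j, F i j *m H + H *m (F i j)^T = 0) ->
  (forall k i j, N k i j *m H + H *m (N k i j)^T = 0) ->
  (forall i j, \sum_k A k i j = F i j + \sum_k xi k *: N k i j
      - 2 *: \sum_k (F k i *m F k j - F k j *m F k i)) ->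
  let u := - \sum_i \sum_j \tr (F i j *m F i j) in
  u <= 9 / 64 ->
  1 / 10 * u <=
    \sum_k - \sum_i \sum_j 2 * (\tr (A k i j *m F i j) + \tr (N k i j *m N k i j))
    - \sum_k xi k * - \sum_i \sum_j 2 * \tr (N k i j *m F i j).
Proof.
move=> pH cF cN hB u hu.
have T := sum_mxtrace_comm_le pH cF hu; rewrite -/u in T.
have sum3 (f : 'I_n -> 'I_n -> 'I_n -> R) :
    \sum_k - \sum_i \sum_j f k i j = - \sum_i \sum_j \sum_k f k i j.
  rewrite sumrN exchange_big /=; congr (- _); apply: eq_bigr => i _.
  exact: exchange_big.
rewrite sum3.
have -> : \sum_k xi k * - \sum_i \sum_j 2 * \tr (N k i j *m F i j)
    = - \sum_i \sum_j \sum_k xi k * (2 * \tr (N k i j *m F i j)).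
  rewrite -sum3; apply: eq_bigr => k _; rewrite mulrN; congr (- _).
  by rewrite mulr_sumr; apply: eq_bigr => i _; rewrite mulr_sumr.
set T3 := \sum_i \sum_j \sum_k _ in T.
pose NN := \sum_i \sum_j \sum_k \tr (N k i j *m N k i j).
have NN0 : NN <= 0.
  rewrite -oppr_ge0 -sumrN; apply: sumr_ge0 => i _; rewrite -sumrN.
  apply: sumr_ge0 => j _; rewrite -sumrN; apply: sumr_ge0 => k _.
  by rewrite oppr_ge0; exact: mxtrace_sqr_le0 (cN k i j).
have term i j : \sum_k 2 * (\tr (A k i j *m F i j) + \tr (N k i j *m N k i j))
     - \sum_k xi k * (2 * \tr (N k i j *m F i j))
   = 2 * \tr (F i j *m F i j)
     - 4 * \sum_k \tr ((F k i *m F k j - F k j *m F k i) *m F i j)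
     + 2 * \sum_k \tr (N k i j *m N k i j).
  rewrite -mulr_sumr big_split /=.
  have -> : \sum_k \tr (A k i j *m F i j) = \tr (F i j *m F i j)
     + \sum_k xi k * \tr (N k i j *m F i j)
     - 2 * \sum_k \tr ((F k i *m F k j - F k j *m F k i) *m F i j).
    rewrite -[LHS](raddf_sum (@mxtrace R r)) -mulmx_suml hB mulmxBl mulmxDl.
    rewrite -scalemxAl !mulmx_suml.
    rewrite (raddfB (@mxtrace R r)) /= mxtraceD mxtraceZ !(raddf_sum (@mxtrace R r)) /=.
    congr (_ + _ - _); apply: eq_bigr => k _.
    by rewrite -scalemxAl mxtraceZ.
  have -> : \sum_k xi k * (2 * \tr (N k i j *m F i j))
     = 2 * \sum_k xi k * \tr (N k i j *m F i j).
    by rewrite mulr_sumr; apply: eq_bigr => k _; rewrite mulrCA.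
  by lra.
have -> : - \sum_i \sum_j \sum_k 2 * (\tr (A k i j *m F i j) + \tr (N k i j *m N k i j))
   - - \sum_i \sum_j \sum_k xi k * (2 * \tr (N k i j *m F i j))
   = 2 * u + 4 * T3 - 2 * NN.
  rewrite -opprD -sumrB /u /T3 /NN !mulrN -!mulNr !mulr_sumr -!big_split /=.
  rewrite -sumrN; apply: eq_bigr => i _.
  rewrite -sumrB !mulr_sumr -!big_split /= -sumrN; apply: eq_bigr => j _.
  rewrite term; lra.
by lra.
Qed.

Variables (U : set 'rV[R]_n) (G : 'I_n -> 'rV[R]_n -> 'M[R]_r).
Variable H : 'rV[R]_n -> 'M[R]_r.
Hypothesis oU : open U.
Hypothesis sG : forall i, smooth U (G i).
Hypothesis sH : smooth U H.
Hypothesis pdH : forall i x, U x -> pd i H x = G i x *m H x + H x *m (G i x)^T.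

Let metric_skew (M : 'rV[R]_n -> 'M[R]_r) :=
  forall x, U x -> M x *m H x + H x *m (M x)^T = 0.

Lemma curv_skew_algebra (h a b da db dda ddb : 'M[R]_r) :
  dda = ddb ->
  dda = da *m h + b *m (a *m h + h *m a^T)
    + ((a *m h + h *m a^T) *m b^T + h *m da^T) ->
  ddb = db *m h + a *m (b *m h + h *m b^T)
    + ((b *m h + h *m b^T) *m a^T + h *m db^T) ->
  (da - db + b *m a - a *m b) *m h + h *m (da - db + b *m a - a *m b)^T = 0.
Proof.
move=> E Ea Eb; rewrite !(linearD, linearN) /= !trmx_mul.
transitivity (dda - ddb); last by rewrite E subrr.
rewrite {}Ea {}Eb; move: a^T b^T da^T db^T => *; mx_ring.
Qed.

Lemma pd_metric_skew i (M : 'rV[R]_n -> 'M[R]_r) x : U x -> smooth U M ->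
  pd i (fun y => M y *m H y + H y *m (M y)^T) x
  = pd i M x *m H x + M x *m (G i x *m H x + H x *m (G i x)^T)
    + ((G i x *m H x + H x *m (G i x)^T) *m (M x)^T + H x *m (pd i M x)^T).
Proof.
move=> Ux sM; have sMt := smooth_tr oU sM; have s1 := smooth_mulmx oU sM sH.
have s2 := smooth_mulmx oU sH sMt; rewrite [LHS](pdD i Ux s1 s2).
rewrite (pd_mulmx i Ux oU sM sH) (pd_mulmx i Ux oU sH sMt) (pd_tr i Ux oU sM).
by rewrite (pdH i Ux).
Qed.

(** Mixed second derivatives of [H] commute; expanding both with the compatibility equation [pdH]
    leaves exactly the skewness of the curvature. *)
Lemma curv_skew i j : metric_skew (curv G i j).
Proof.
move=> x Ux; have dd k l : pd k (pd l H) x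
    = pd k (fun y => G l y *m H y + H y *m (G l y)^T) x.
  by apply: eq_in_pd oU Ux _ => y Uy; exact: pdH.
exact: curv_skew_algebra (pdC_mx i j oU Ux sH)
  (etrans (dd i j) (pd_metric_skew i Ux (sG j)))
  (etrans (dd j i) (pd_metric_skew j Ux (sG i))).
Qed.

Lemma nab_skew_algebra (h g m dm : 'M[R]_r) : m *m h + h *m m^T = 0 ->
  dm *m h + m *m (g *m h + h *m g^T) + ((g *m h + h *m g^T) *m m^T + h *m dm^T) = 0 ->
  (dm + m *m g - g *m m) *m h + h *m (dm + m *m g - g *m m)^T = 0.
Proof.
move=> E E'; rewrite !(linearD, linearN) /= !trmx_mul.
transitivity (dm *m h + m *m (g *m h + h *m g^T)
   + ((g *m h + h *m g^T) *m m^T + h *m dm^T)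
   - g *m (m *m h + h *m m^T) - (m *m h + h *m m^T) *m g^T).
  by move: dm^T m^T g^T {E E'} => *; mx_ring.
by rewrite E E' mulmx0 mul0mx !subr0.
Qed.

(** The metric is parallel, so differentiating $MH+HM^T=0$ gives the same identity for the covariant
    derivative. *)
Lemma nab_skew k (M : 'rV[R]_n -> 'M[R]_r) : smooth U M -> metric_skew M ->
  metric_skew (nab G k M).
Proof.
move=> sM cM x Ux; apply: nab_skew_algebra (cM x Ux) _.
rewrite -(pd_metric_skew k Ux sM); apply: etrans (pd_cst (0 : 'M[R]_r) k x).
exact: eq_in_pd oU Ux cM.
Qed.

Lemma mxtrace_nab_algebra (m p dm dp g : 'M[R]_r) :
  \tr (dm *m p + m *m dp)
  = \tr ((dm + m *m g - g *m m) *m p) + \tr (m *m (dp + p *m g - g *m p)).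
Proof.
rewrite -linearD /=.
have -> : (dm + m *m g - g *m m) *m p + m *m (dp + p *m g - g *m p)
  = (dm *m p + m *m dp) + (m *m p *m g - g *m (m *m p)) by mx_ring.
by rewrite [RHS]linearD /= linearB /= (mxtrace_mulC g) subrr addr0.
Qed.

(** The connection terms assemble into the commutator of [M *m N] with the connection matrix, whose
    trace is zero. *)
Lemma pd_mxtrace_mul k (M N : 'rV[R]_n -> 'M[R]_r) x : U x ->
  smooth U M -> smooth U N ->
  pd k (fun y => \tr (M y *m N y) : R) x
  = \tr (nab G k M x *m N x) + \tr (M x *m nab G k N x).
Proof.
move=> Ux sM sN; rewrite (pd_mxtrace k Ux oU (smooth_mulmx oU sM sN)).
by rewrite (pd_mulmx k Ux oU sM sN); exact: mxtrace_nab_algebra.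
Qed.

Lemma pd_sum2 k (f : 'I_n -> 'I_n -> 'rV[R]_n -> R) x : U x ->
  (forall i j, smooth U (f i j)) ->
  pd k (fun y => - \sum_i \sum_j f i j y : R) x = - \sum_i \sum_j pd k (f i j) x.
Proof.
move=> Ux sf; have s1 i : smooth U (fun y => \sum_j f i j y : R) by exact: smooth_sum.
have s2 : smooth U (fun y => \sum_i \sum_j f i j y : R) by exact: smooth_sum.
rewrite (pdN k Ux s2) (pd_sum k Ux _ oU s1); congr (- _); apply: eq_bigr => i _.
exact: (pd_sum k Ux _ oU (sf i)).
Qed.

Lemma drift_laplacian_ge x : U x -> posdef (H x) ->
  (forall y j, U y ->
    \sum_i nab G i (curv G i j) y = \sum_i (y 0 i / 2) *: curv G i j y) ->
  let u y : R := - \sum_i \sum_j \tr (curv G i j y *m curv G i j y) in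
  u x <= 9 / 64 ->
  1 / 10 * u x <= \sum_k pd k (pd k u) x - \sum_k x 0 k / 2 * pd k u x.
Proof.
move=> Ux pH sol u hu.
have sc i j := smooth_curv oU sG i j.
have sn k i j := smooth_nab oU sG k (sc i j).
have strace (M N : 'rV[R]_n -> 'M[R]_r) : smooth U M -> smooth U N ->
    smooth U (fun y => \tr (M y *m N y) : R).
  by move=> sM sN; apply: smooth_mxtrace => //; exact: smooth_mulmx.
have pdu k y : U y -> pd k u y
    = - \sum_i \sum_j 2 * \tr (nab G k (curv G i j) y *m curv G i j y).
  move=> Uy; apply: etrans (pd_sum2 k Uy (fun i j => strace _ _ (sc i j) (sc i j))) _.
  congr (- _); apply: eq_bigr => i _; apply: eq_bigr => j _.
  rewrite (pd_mxtrace_mul k Uy (sc i j) (sc i j)) [X in _ + X]mxtrace_mulC.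
  by rewrite mulr_natl mulr2n.
have pdpdu k : pd k (pd k u) x
    = - \sum_i \sum_j 2 * (\tr (nab G k (nab G k (curv G i j)) x *m curv G i j x)
       + \tr (nab G k (curv G i j) x *m nab G k (curv G i j) x)).
  apply: etrans (eq_in_pd k oU Ux (fun y Uy => pdu k y Uy)) _.
  have s2 i j : smooth U (fun y => 2 * \tr (nab G k (curv G i j) y *m curv G i j y) : R).
    by apply: smoothM => //; [exact: smooth_cst|exact: strace].
  apply: etrans (pd_sum2 k Ux s2) _.
  congr (- _); apply: eq_bigr => i _; apply: eq_bigr => j _.
  have := pdM k Ux (@smooth_cst R n _ U (2 : R)) (strace _ _ (sn k i j) (sc i j)).
  rewrite (pd_cst (2 : R) k x) mul0r add0r => E; apply: etrans E _.
  by rewrite (pd_mxtrace_mul k Ux (sn k i j) (sc i j)).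
have -> : \sum_k pd k (pd k u) x = \sum_k - \sum_i \sum_j 2 *
    (\tr (nab G k (nab G k (curv G i j)) x *m curv G i j x)
       + \tr (nab G k (curv G i j) x *m nab G k (curv G i j) x)).
  by apply: eq_bigr => k _; exact: pdpdu.
have -> : \sum_k x 0 k / 2 * pd k u x = \sum_k x 0 k / 2 *
    - \sum_i \sum_j 2 * \tr (nab G k (curv G i j) x *m curv G i j x).
  by apply: eq_bigr => k _; rewrite pdu.
exact: (drift_laplacian_algebra pH (fun i j => curv_skew i j Ux)
  (fun k i j => nab_skew k (sc i j) (curv_skew i j) Ux)
  (fun i j => bochner oU sG sol i j Ux) hu).
Qed.

End DriftLaplacian.
(** * Vector bundles in a chart *)

Section CoordinateMap.
Import passmx.
Variables (R : realType) (V : vectType R) (r : nat) (phi : 'Hom(V, 'rV[R]_r)).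
Hypothesis phi_bij : bijective phi.

Lemma bij_lfunK : cancel phi (phi^-1)%VF.
Proof. by apply: lker0_lfunK; apply/lker0P; exact: bij_inj. Qed.

Lemma bij_lfunVK : cancel (phi^-1)%VF phi.
Proof. by move=> v; have [psi K K'] := phi_bij; rewrite -{1}(K' v) bij_lfunK K'. Qed.

Lemma eq_mulmxl m p (A B : 'M[R]_(m, p)) :
  (forall u : 'rV[R]_m, u *m A = u *m B) -> A = B.
Proof. by move=> H; apply/row_matrixP => i; rewrite !rowE H. Qed.

(** [trace] is computed in the abstract basis [vbasis], so independence of the basis is needed: [P]
    and [Q] are the mutually inverse transition matrices to the coordinates [phi]. *)
Lemma trace_coord (A : 'End(V)) (M : 'M[R]_r) :
  (forall v, phi (A v) = phi v *m M) -> trace A = \tr M.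
Proof.
move=> AM; rewrite /trace; set e := vbasis _.
have eb : basis_of fullv e by exact: vbasisP.
pose Q := lin1_mx (phi \o vecof e).
pose P := lin1_mx (rVof e \o (phi^-1)%VF).
have QE u : u *m Q = phi (vecof e u) by rewrite mul_rV_lin1.
have PE u : u *m P = rVof e ((phi^-1)%VF u) by rewrite mul_rV_lin1.
have QP : Q *m P = 1%:M.
  by apply: eq_mulmxl => u; rewrite mulmxA QE PE bij_lfunK vecofK // mulmx1.
have PQ : P *m Q = 1%:M.
  by apply: eq_mulmxl => u; rewrite mulmxA PE QE rVofK // bij_lfunVK mulmx1.
have E : mxof e e A *m Q = Q *m M.
  apply: eq_mulmxl => u; rewrite !mulmxA mul_mxof !QE rVofK //.
by rewrite -[mxof e e A]mulmx1 -QP mulmxA E mxtrace_mulC mulmxA PQ mul1mx.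
Qed.

End CoordinateMap.

(** * Sections, frames and the connection matrix of a chart *)

Section ChartCoordinates.
Variables (R : realType) (n : nat) (E : vector_bundle R n) (h : fibre_metric E).
Variables (D : connection h) (a : chart E).

Let U := dom a.
Let oU : open U := @dom_open _ _ _ a.

Definition chart_section (sigma : 'rV[R]_n -> 'rV[R]_(rank E)) : section E :=
  fun y => (triv a y)^-1%VF (sigma y).

Definition frame (b : 'I_(rank E)) : section E :=
  chart_section (fun=> delta_mx 0 b).

Lemma triv_chart_section sigma y : U y -> triv a y (chart_section sigma y) = sigma y.
Proof. by move=> Uy; rewrite bij_lfunVK //; exact: triv_bij. Qed.

Lemma triv_inj y : U y -> injective (triv a y).
Proof. by move=> Uy; apply: bij_inj; exact: triv_bij. Qed.

Lemma smooth_sectionW (W W' : set 'rV[R]_n) (s : section E) :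
  W' `<=` W -> smooth_section W s -> smooth_section W' s.
Proof. by move=> sW ss b; apply: smooth_sub (ss b) => x [/sW Wx bx]. Qed.

Lemma eq_in_smooth_section (W : set 'rV[R]_n) (s t : section E) : open W ->
  (forall y, W y -> s y = t y) -> smooth_section W s -> smooth_section W t.
Proof.
move=> oW st ss b; apply: eq_in_smooth (ss b); first exact: openI (@dom_open _ _ _ b).
by move=> y [Wy _]; rewrite st.
Qed.

(** The atlas gives smooth transition maps on constant vectors only, so [sigma] is expanded in the
    standard basis with smooth coefficients. *)
Lemma smooth_chart_section (W : set 'rV[R]_n) sigma : open W -> W `<=` U ->
  smooth W sigma -> smooth_section W (chart_section sigma).
Proof.
move=> oW WU ss b; have oWb : open (W `&` dom b) by exact: openI (@dom_open _ _ _ b).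
have sc c : smooth (W `&` dom b)
    (fun x => sigma x 0 c *: triv b x ((triv a x)^-1%VF (delta_mx 0 c))).
  apply: smoothZ => //.
    by apply: smooth_sub ((smooth_mxP _ oW).1 ss 0 c) => x [].
  by apply: smooth_sub (triv_smooth b a (delta_mx 0 c)) => x [/WU].
apply: eq_in_smooth (smooth_sum (index_enum 'I_(rank E)) oWb sc) => // y _.
rewrite /chart_section [sigma y in RHS]row_sum_delta !linear_sum.
by apply: eq_bigr => c _; rewrite !linearZ.
Qed.

Lemma smooth_frame b : smooth_section U (frame b).
Proof. by apply: smooth_chart_section => //; exact: smooth_cst. Qed.

Lemma smooth_coords (W : set 'rV[R]_n) (s : section E) : W `<=` U ->
  smooth_section W s -> smooth W (fun y => triv a y (s y)).
Proof. by move=> WU /(_ a); apply: smooth_sub => y Wy; split=> //; exact: WU. Qed.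

Lemma chart_sectionE (s : section E) y : U y ->
  s y = \sum_b triv a y (s y) 0 b *: frame b y.
Proof.
move=> Uy; apply: (triv_inj Uy); rewrite linear_sum [LHS]row_sum_delta.
by apply: eq_bigr => b _; rewrite linearZ /= [triv a y (frame b y)]triv_chart_section.
Qed.

Section Sums.
Variables (W : set 'rV[R]_n) (oW : open W) (WU : W `<=` U).

Lemma smooth_section0 : smooth_section W (fun y => 0 : E y).
Proof.
move=> b; apply: eq_in_smooth (smooth_cst _ 0); first exact: openI (@dom_open _ _ _ b).
by move=> y _; rewrite linear0.
Qed.

Lemma smooth_sectionD (s t : section E) : smooth_section W s -> smooth_section W t ->
  smooth_section W (fun y => s y + t y).
Proof.
move=> ss st b; have oWb : open (W `&` dom b) by exact: openI (@dom_open _ _ _ b).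
by apply: eq_in_smooth (smoothD oWb (ss b) (st b)) => // y _; rewrite linearD.
Qed.

Lemma smooth_sectionZ (f : 'rV[R]_n -> R) (s : section E) : smooth W f ->
  smooth_section W s -> smooth_section W (fun y => f y *: s y).
Proof.
move=> sf ss b; have oWb : open (W `&` dom b) by exact: openI (@dom_open _ _ _ b).
have sfb : smooth (W `&` dom b) f by apply: smooth_sub sf => x [].
by apply: eq_in_smooth (smoothZ oWb sfb (ss b)) => // y _; rewrite linearZ.
Qed.

Lemma nabla0 y : W y -> D (fun z => 0 : E z) y = 0.
Proof.
move=> Wy; have := nablaD D oW smooth_section0 smooth_section0 Wy.
rewrite (_ : (fun z => 0 + 0 : E z) = (fun z => 0 : E z)); last first.
  by apply: functional_extensionality_dep => z; rewrite addr0.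
by move=> /eqP; rewrite -subr_eq0 opprD addrA subrr sub0r oppr_eq0 => /eqP.
Qed.

Lemma nabla_sum (I : Type) (l : seq I) (s : I -> section E) y :
  (forall i, smooth_section W (s i)) -> W y ->
  smooth_section W (fun z => \sum_(i <- l) s i z) /\
  D (fun z => \sum_(i <- l) s i z) y = \sum_(i <- l) D (s i) y.
Proof.
move=> ss Wy; elim: l => [|i l [IHs IH]].
  have -> : (fun z => \sum_(i <- [::]) s i z) = (fun z => 0 : E z).
    by apply: functional_extensionality_dep => z; rewrite big_nil.
  by split; [exact: smooth_section0 | rewrite nabla0 // big_nil].
have -> : (fun z => \sum_(j <- i :: l) s j z) = (fun z => s i z + \sum_(j <- l) s j z).
  by apply: functional_extensionality_dep => z; rewrite big_cons.
split; first exact: smooth_sectionD.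
by rewrite (nablaD D oW (ss i) IHs Wy) IH big_cons.
Qed.

End Sums.

(** The connection form in the frame of the chart. Placing the coordinates of the derivative of the
    [b]-th frame section in row [b] matches the convention $\partial_is+sG_i$ on row vectors. *)
Definition conn_mx (i : 'I_n) (y : 'rV[R]_n) : 'M[R]_(rank E) :=
  \matrix_(b, c) triv a y (cov D i (frame b) y) 0 c.

Lemma row_conn_mx i y b : row b (conn_mx i y) = triv a y (cov D i (frame b) y).
Proof. by apply/rowP => c; rewrite !mxE. Qed.

Lemma smooth_conn_mx i : smooth U (conn_mx i).
Proof.
apply/(smooth_mxP _ oU) => b c.
have s1 : smooth_section U (cov D i (frame b)).
  exact: nabla_smooth (ebase R i) oU (smooth_frame b).
have s2 := (smooth_mxP _ oU).1 (smooth_coords (@subset_refl _ U) s1) 0 c.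
by apply: eq_in_smooth s2 => // y _; rewrite mxE.
Qed.

(** The section agrees with its frame expansion only on [W], so [nabla_local] is what permits
    replacing one by the other; additivity and the Leibniz rule do the rest. *)
Lemma cov_coord (W : set 'rV[R]_n) (s : section E) i y : open W -> W `<=` U ->
  smooth_section W s -> W y ->
  triv a y (cov D i s y)
  = pd i (fun z => triv a z (s z)) y + triv a y (s y) *m conn_mx i y.
Proof.
move=> oW WU ss Wy; have Uy := WU _ Wy.
have sc := smooth_coords WU ss; have sce := (smooth_mxP _ oW).1 sc 0.
have sf b : smooth_section W (frame b) by exact: smooth_sectionW (smooth_frame b).
have sfs b := smooth_sectionZ oW (sce b) (sf b).
have Ds := nabla_local D oW ss (fun x Wx => chart_sectionE s (WU _ Wx)) Wy.
rewrite /cov Ds (nabla_sum oW (index_enum 'I_(rank E)) sfs Wy).2.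
rewrite sum_lfunE linear_sum.
rewrite [X in X + _]row_sum_delta (mulmx_sum_row _ (conn_mx i y)) -big_split /=.
apply: eq_bigr => b _; rewrite (nabla_leibniz D oW (sce b) (sf b) Wy).
rewrite linearD !linearZ /= row_conn_mx [triv a y (frame b y)]triv_chart_section //.
by rewrite (pd_mx i Wy 0 b sc).
Qed.

(** A coordinate formula for [T] supplies the witness that keeps [tensor_at] away from its default
    value 0. Any [v] is then reached by the local section with constant coordinates through [v]. *)
Lemma tensor_at_coord x (T : section E -> E x) (M : 'M[R]_(rank E)) : U x ->
  (forall W s, open W -> W x -> W `<=` U -> smooth_section W s ->
     triv a x (T s) = triv a x (s x) *m M) ->
  forall v, triv a x (tensor_at T v) = triv a x v *m M.
Proof.
move=> Ux TM v.
have TM' (W : set 'rV[R]_n) s : open W -> W x -> smooth_section W s ->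
    triv a x (T s) = triv a x (s x) *m M.
  move=> oW Wx ss; apply: (TM (W `&` U)) => //; first exact: openI.
  by apply: smooth_sectionW ss => y [].
pose A : 'End(E x) := ((triv a x)^-1 \o linfun (mulmxr M) \o triv a x)%VF.
have AE w : triv a x (A w) = triv a x w *m M.
  by rewrite !comp_lfunE lfunE /= bij_lfunVK //; exact: triv_bij.
have := @xgetPex _ 0 [set A : 'End(E x) | forall (W : set 'rV[R]_n) (s : section E),
  open W -> W x -> smooth_section W s -> A (s x) = T s].
rewrite -/(tensor_at T) => /(_ _)/wrap[|H].
  exists A => W s oW Wx ss; apply: (triv_inj Ux); rewrite AE.
  by rewrite -(TM' W s).
have sv := smooth_chart_section oU (@subset_refl _ U) (smooth_cst U (triv a x v)).
have vE : chart_section (fun=> triv a x v) x = v.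
  by apply: (triv_inj Ux); rewrite triv_chart_section.
by rewrite -{1}vE (H U _ oU Ux sv) (TM' U _ oU Ux sv) vE.
Qed.

End ChartCoordinates.

(** * Curvature, soliton equation and metric in a chart *)

Section ChartCurvature.
Variables (R : realType) (n : nat) (E : vector_bundle R n) (h : fibre_metric E).
Variables (D : connection h) (a : chart E).

Let U := dom a.
Let oU : open U := @dom_open _ _ _ a.
Let G := conn_mx D a.
Let sG i : smooth U (G i) := smooth_conn_mx D a i.

Lemma curvature_algebra (s si sj sij : 'rV[R]_(rank E)) (Gi Gj dGi dGj : 'M[R]_(rank E)) :
  (sij + (si *m Gj + s *m dGj) + (sj + s *m Gj) *m Gi)
  - (sij + (sj *m Gi + s *m dGi) + (si + s *m Gi) *m Gj)
  = s *m (dGj - dGi + Gj *m Gi - Gi *m Gj).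
Proof. by mx_ring. Qed.

Lemma curvature_coord i j x (v : E x) : U x ->
  triv a x (curvature D i j x v) = triv a x v *m curv G i j x.
Proof.
move=> Ux; apply: tensor_at_coord => // W s oW Wx WU ss.
have sc := smooth_coords WU ss.
have sGW k : smooth W (G k) := smooth_sub WU (sG k).
have scov k : smooth_section W (cov D k s) := nabla_smooth D (ebase R k) oW ss.
have covcov k l : triv a x (cov D k (cov D l s) x)
    = pd k (pd l (fun z => triv a z (s z))) x
      + (pd k (fun z => triv a z (s z)) x *m G l x + triv a x (s x) *m pd k (G l) x)
      + (pd l (fun z => triv a z (s z)) x + triv a x (s x) *m G l x) *m G k x.
  rewrite (cov_coord D k oW WU (scov l) Wx) (cov_coord D l oW WU ss Wx); congr (_ + _).
  rewrite (eq_in_pd k oW Wx (fun y Wy => cov_coord D l oW WU ss Wy)).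
  rewrite (pdD k Wx (smooth_pd l sc) (smooth_mulmx oW sc (sGW l))).
  by rewrite (pd_mulmx k Wx oW sc (sGW l)).
rewrite linearB /= (covcov i j) (covcov j i) (pdC_mx j i oW Wx sc).
exact: curvature_algebra.
Qed.

Lemma cov_endo_algebra (s si : 'rV[R]_(rank E)) (Gi M dM : 'M[R]_(rank E)) :
  (si *m M + s *m dM) + (s *m M) *m Gi - (si + s *m Gi) *m M
  = s *m (dM + M *m Gi - Gi *m M).
Proof. by mx_ring. Qed.

Lemma cov_endo_coord i (A : endo_field E) (M : 'rV[R]_n -> 'M[R]_(rank E)) x (v : E x) :
  U x -> smooth U M ->
  (forall y (w : E y), U y -> triv a y (A y w) = triv a y w *m M y) ->
  triv a x (cov_endo D i A x v) = triv a x v *m nab G i M x.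
Proof.
move=> Ux sM AM; apply: tensor_at_coord => // W s oW Wx WU ss.
have sc := smooth_coords WU ss; have sMW := smooth_sub WU sM.
have sAs : smooth_section W (fun y => A y (s y)).
  apply: eq_in_smooth_section oW _ (smooth_chart_section oW WU (smooth_mulmx oW sc sMW)).
  move=> y Wy; apply: (triv_inj (WU _ Wy)).
  by rewrite triv_chart_section ?AM //; exact: WU.
rewrite linearB /= (AM _ _ Ux) (cov_coord D i oW WU sAs Wx) (cov_coord D i oW WU ss Wx).
rewrite (eq_in_pd i oW Wx (fun y Wy => AM y (s y) (WU _ Wy))) (AM _ _ Ux).
rewrite (pd_mulmx i Wx oW sc sMW); exact: cov_endo_algebra.
Qed.

Lemma chart_endo_eq x (M N : 'M[R]_(rank E)) : U x ->
  (forall v : E x, triv a x v *m M = triv a x v *m N) -> M = N.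
Proof.
move=> Ux H; apply: eq_mulmxl => u.
by rewrite -[u](triv_chart_section (fun=> u) Ux) H.
Qed.

Lemma soliton_chart x j : soliton D -> U x ->
  \sum_i nab G i (curv G i j) x = \sum_i (x 0 i / 2) *: curv G i j x.
Proof.
move=> sol Ux; apply: (chart_endo_eq Ux) => v.
have /eqP := sol x j; rewrite /Dstar /vcontract addrC subr_eq0 => /eqP E0.
have E1 := congr1 (fun A : 'End(E x) => triv a x (A v)) E0.
rewrite /= !sum_lfunE in E1; rewrite !mulmx_sumr.
transitivity (\sum_i triv a x (cov_endo D i (curvature D i j) x v)).
  apply: eq_bigr => i _; symmetry; apply: cov_endo_coord => //.
    exact: smooth_curv.
  by move=> y w Uy; exact: curvature_coord.
apply: (etrans (esym (linear_sum (triv a x) _ _ _))); apply: (etrans (esym E1)).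
rewrite linear_sum; apply: eq_bigr => i _.
rewrite scale_lfunE linearZ /= curvature_coord // mxE -scalemxAr.
by rewrite mulrC.
Qed.

Definition metric_mx (y : 'rV[R]_n) : 'M[R]_(rank E) :=
  \matrix_(b, c) h y (frame a b y) (frame a c y).

Lemma smooth_metric_mx : smooth U metric_mx.
Proof.
apply/(smooth_mxP _ oU) => b c.
apply: eq_in_smooth (metric_smooth h oU (smooth_frame a b) (smooth_frame a c)) => //.
by move=> y _; rewrite mxE.
Qed.

Lemma metric_suml y (f : 'I_(rank E) -> R) (e : 'I_(rank E) -> E y) (w : E y) :
  h y (\sum_b f b *: e b) w = \sum_b f b * h y (e b) w.
Proof. by rewrite linear_sumlz; apply: eq_bigr => b _; rewrite linearZl_LR. Qed.

Lemma metricC y (v w : E y) : h y v w = h y w v.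
Proof. by rewrite hermC expr0 mul1r. Qed.

Lemma metric_mxE y (v w : E y) : U y ->
  h y v w = \tr (triv a y v *m metric_mx y *m (triv a y w)^T).
Proof.
move=> Uy; rewrite mxtrace11 mxE.
pose s (u : E y) : section E := chart_section a (fun=> triv a y u).
have sE u : u = \sum_b triv a y u 0 b *: frame a b y.
  rewrite -[LHS](_ : s u y = u); last first.
    by apply: (triv_inj Uy); rewrite triv_chart_section.
  by rewrite {1}(chart_sectionE (s u) Uy) triv_chart_section.
rewrite {1}(sE w) metricC metric_suml; apply: eq_bigr => c _.
rewrite mxE [X in _ = _ * X]mxE mulrC; congr (_ * _).
rewrite metricC {1}(sE v) metric_suml; apply: eq_bigr => b _.
by rewrite mxE.
Qed.

Lemma posdef_metric_mx y : U y -> posdef (metric_mx y).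
Proof.
move=> Uy; split; first by apply/matrixP => b c; rewrite !mxE metricC.
move=> v v0; set w := chart_section a (fun=> v) y.
have wv : triv a y w = v by rewrite triv_chart_section.
rewrite -{1}wv -wv -metric_mxE //; apply: neq0_dnorm_gt0.
by apply: contra v0 => /eqP w0; rewrite -wv w0 linear0.
Qed.

(** Metric compatibility applied to pairs of frame sections; this is the equation on [H] from which
    skewness of the curvature was derived. *)
Lemma pd_metric_mx i y : U y ->
  pd i metric_mx y = G i y *m metric_mx y + metric_mx y *m (G i y)^T.
Proof.
move=> Uy; apply/matrixP => b c; rewrite (pd_mx i Uy b c smooth_metric_mx).
have -> : pd i (fun z => metric_mx z b c : R) y
    = pd i (fun z => h z (frame a b z) (frame a c z) : R) y.
  by apply: eq_in_pd oU Uy _ => z _; rewrite mxE.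
rewrite [LHS](nabla_metric D oU (smooth_frame a b) (smooth_frame a c) Uy).
have frow d : D (frame a d) y (ebase R i) = \sum_e G i y d e *: frame a e y.
  apply: (triv_inj Uy); rewrite linear_sum.
  have := row_conn_mx D a i y d; rewrite /cov => <-.
  rewrite [LHS]row_sum_delta; apply: eq_bigr => e _.
  by rewrite linearZ /= [triv a y (frame a e y)]triv_chart_section // [row d _ _ _]mxE.
rewrite !frow [RHS]addmxE !mxE; congr (_ + _).
  by rewrite metric_suml; apply: eq_bigr => e _; rewrite [metric_mx _ _ _]mxE.
rewrite metricC metric_suml; apply: eq_bigr => e _.
by rewrite [metric_mx _ _ _]mxE [(_^T) _ _]mxE mulrC metricC.
Qed.

Lemma endo_inner_chart i j x : U x ->
  endo_inner (curvature D i j x) (curvature D i j x)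
  = - \tr (curv G i j x *m curv G i j x).
Proof.
move=> Ux; rewrite /endo_inner; congr (- _).
apply: (trace_coord (triv_bij Ux)) => v.
by rewrite comp_lfunE !curvature_coord // mulmxA.
Qed.

End ChartCurvature.

(** * From charts to the global conclusion *)

Lemma sqrtr_le_sqr (R : realType) (S c : R) : 0 <= c -> Num.sqrt S <= c -> S <= c ^+ 2.
Proof.
(* [Num.sqrt] is 0 on negative numbers, so a nonpositive [S] is treated apart. *)
move=> c0 h; have [S0|S0] := leP S 0; first by rewrite (le_trans S0) ?sqr_ge0.
by rewrite -(sqr_sqrtr (ltW S0)); apply: lerXn2r; rewrite ?nnegrE ?sqrtr_ge0.
Qed.


Theorem theorem1p1 (R : realType) (n : nat) (E : vector_bundle R n)
    (h : fibre_metric E) (D : connection h)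
    (hsol : soliton D)
    (hbound : forall x : 'rV[R]_n, curvature_norm D x <= 3%:R / 8%:R) :
  flat D.
Proof.
pose u (x : 'rV[R]_n) : R := \sum_i \sum_j
  endo_inner (curvature D i j x) (curvature D i j x).
pose K (a : chart E) := curv (conn_mx D a).
(* The function [u] is defined without charts. On [dom a] it coincides with the matrix expression
   [uloc a], and since smoothness and the differential inequality are local, both transfer from
   [uloc a] to [u]. *)
pose uloc (a : chart E) (x : 'rV[R]_n) : R :=
  - \sum_i \sum_j \tr (K a i j x *m K a i j x).
have ulocE a x : dom a x -> uloc a x = u x.
  move=> ax; rewrite /uloc -sumrN; apply: eq_bigr => i _; rewrite -sumrN.
  by apply: eq_bigr => j _; rewrite (endo_inner_chart D i j ax).
have oa (a : chart E) : open (dom a) by exact: dom_open.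
have sG (a : chart E) i := smooth_conn_mx D a i.
have skewK (a : chart E) i j x : dom a x ->
    K a i j x *m metric_mx h a x + metric_mx h a x *m (K a i j x)^T = 0.
  move=> ax; exact: (curv_skew (oa a) (sG a) (smooth_metric_mx h a)
    (pd_metric_mx D (a := a)) i j ax).
have u_le x : u x <= 9 / 64.
  have -> : 9 / 64 = (3%:R / 8%:R) ^+ 2 :> R by field.
  by apply: sqrtr_le_sqr; [rewrite divr_ge0 // ler0n | exact: hbound].
have su : smooth setT u.
  apply: smooth_local => x _; have [a ax] := dom_cover E x; exists (dom a) => //.
  have s2 i j : smooth (dom a) (fun y => \tr (K a i j y *m K a i j y) : R).
    by apply: smooth_mxtrace => //; apply: smooth_mulmx => //; exact: smooth_curv.
  have s1 : smooth (dom a) (fun y => \sum_i \sum_j - \tr (K a i j y *m K a i j y) : R).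
    apply: smooth_sum => // i; apply: smooth_sum => // j.
    have sN1 := @smooth_cst R n _ (dom a) (-1 : R).
    apply: eq_in_smooth (smoothM (oa a) sN1 (s2 i j)) => //.
    by move=> y _; rewrite mulN1r.
  apply: eq_in_smooth s1 => // y ay; rewrite -(ulocE _ _ ay) /uloc -sumrN.
  by apply: eq_bigr => i _; rewrite -sumrN.
have u_drift x : 1 / 10 * u x
    <= \sum_k pd k (pd k u) x - \sum_k x 0 k / 2 * pd k u x.
  have [a ax] := dom_cover E x.
  have drift : uloc a x <= 9 / 64 -> 1 / 10 * uloc a x
      <= \sum_k pd k (pd k (uloc a)) x - \sum_k x 0 k / 2 * pd k (uloc a) x
    := drift_laplacian_ge (oa a) (sG a) (smooth_metric_mx h a)
      (pd_metric_mx D (a := a)) ax (posdef_metric_mx h ax)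
      (fun y j ay => soliton_chart j hsol ay).
  have pdE k y (ay : dom a y) : pd k (uloc a) y = pd k u y.
    exact: eq_in_pd (oa a) ay (fun z az => ulocE a z az).
  have E1 : \sum_k pd k (pd k (uloc a)) x = \sum_k pd k (pd k u) x.
    by apply: eq_bigr => k _; exact: eq_in_pd (oa a) ax (fun y ay => pdE k y ay).
  have E2 : \sum_k x 0 k / 2 * pd k (uloc a) x = \sum_k x 0 k / 2 * pd k u x.
    by apply: eq_bigr => k _; congr (_ * _); exact: pdE.
  by move: drift; rewrite E1 E2 (ulocE a x ax); apply; exact: u_le.
have c0 : 0 < 1 / 10 :> R by rewrite divr_gt0.
have u_le0 := bounded_subsolution_le0 su c0 u_le u_drift.
move=> x i j; have [a ax] := dom_cover E x.
(* [u] is a sum of nonnegative terms and is nonpositive, so each trace vanishes; positive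
   definiteness of the metric then makes the matrix itself vanish. *)
have K0 : K a i j x = 0.
  apply: mxtrace_sqr_eq0 (posdef_metric_mx h ax) (skewK a i j x ax) _.
  have e0 k l : 0 <= endo_inner (curvature D k l x) (curvature D k l x).
    rewrite (endo_inner_chart D k l ax) oppr_ge0.
    exact: mxtrace_sqr_le0 (posdef_metric_mx h ax) (skewK a k l x ax).
  have le_u : endo_inner (curvature D i j x) (curvature D i j x) <= u x.
    rewrite /u (bigD1 i) //= (bigD1 j) //= -addrA lerDl addr_ge0 //.
      by apply: sumr_ge0.
    by apply: sumr_ge0 => k _; apply: sumr_ge0.
  have := le_trans le_u (u_le0 x); rewrite (endo_inner_chart D i j ax) oppr_le0 => tr0.
  apply/eqP; rewrite eq_le tr0 andbT.
  exact: mxtrace_sqr_le0 (posdef_metric_mx h ax) (skewK a i j x ax).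
apply/lfunP => v; apply: (triv_inj ax).
by rewrite zero_lfunE linear0 curvature_coord // [curv _ _ _ _]K0 mulmx0.
Qed.
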